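(* Let $\Delta\subseteq\mathbb R^n$ be a pure and hereditary finite $n$-dimensional simplicial complex, fix $0\le i\le n-2$, and let $\mathbf r=\{r_\tau:\tau\in\Delta_{n-1}^\circ\}$ and $\mathbf s=\{s_\beta:\beta\in\Delta_i\}$ be families of non-negative integers. Let $f$ be a piecewise polynomial on $\Delta$, i.e. a choice of a polynomial $f|_\sigma\in R=\mathbb R[x_1,\dots,x_n]$ for each $\sigma\in\Delta_n$. Then the following are equivalent: (1) $f\in\mathcal S^{\mathbf r,\mathbf s}(\Delta)$; (2) $\hat f|_{\hat\sigma}-\hat f|_{\hat\sigma'}\in J(\tau)$ for all $\tau\in\Delta_{n-1}^\circ$ and $\sigma,\sigma'\in\Delta_n$ with $\sigma\cap\sigma'=\tau$; (3) $f|_\sigma-f|_{\sigma'}\in\check J(\tau)$ for all $\tau\in\Delta_{n-1}^\circ$ and $\sigma,\sigma'\in\Delta_n$ with $\sigma\cap\sigma'=\tau$.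
   Context: $\Delta_j$ is the set of $j$-dimensional faces of $\Delta$ and $\Delta_j^\circ$ the subset of interior ones (not contained in the boundary). $\Delta$ is pure if all maximal faces have dimension $n$. $\Delta$ is hereditary if for all $\sigma,\sigma'\in\Delta_n$ whose intersection $\beta=\sigma\cap\sigma'$ is a face of $\Delta$ there is a sequence $\sigma=\sigma_0,\sigma_1,\dots,\sigma_m=\sigma'$ of $n$-faces all containing $\beta$ with $\sigma_{k-1}\cap\sigma_k\in\Delta_{n-1}^\circ$ for each $k$. $\mathcal S^{\mathbf r,\mathbf s}(\Delta)$ is the set of piecewise polynomials $f$ on $\Delta$ that define a continuous function on $\Delta$, such that for each $\tau\in\Delta_{n-1}^\circ$ the function $f$ is $C^{r_\tau}$ on the star of $\tau$ (the union of the two $n$-simplices containing $\tau$), and such that for each $\beta\in\Delta_i$ the polynomials $f|_\sigma$, for all $\sigma\in\Delta_n$ having $\beta$ as a face, have common partial derivatives up to order $s_\beta$ at all points of $\beta$. For $\tau\in\Delta_{n-1}^\circ$ let $\check\ell_\tau\in R$ be a degree-one polynomial vanishing on $\tau$, and for $\beta\in\Delta_i$ let $\mathfrak m_\beta\subset R$ be the ideal of all polynomials vanishing on $\beta$. Then $$\check J(\tau)=\langle\check\ell_\tau^{\,r_\tau+1}\rangle\cap\bigcap_{\beta\in\Delta_i,\ \beta\subset\tau}\mathfrak m_\beta^{s_\beta+1}\subseteq R.$$ Let $S=\mathbb R[x_0,x_1,\dots,x_n]$, let $\ell_\tau\in S$ be the linear form homogenizing $\check\ell_\tau$, and let $\hat{\mathfrak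 m}_\beta\subset S$ be the homogenization of $\mathfrak m_\beta$ (the ideal generated by the homogenizations of the elements of $\mathfrak m_\beta$). Then $$J(\tau)=\langle\ell_\tau^{\,r_\tau+1}\rangle\cap\bigcap_{\beta\in\Delta_i,\ \beta\subset\tau}\hat{\mathfrak m}_\beta^{s_\beta+1}\subseteq S.$$ $\hat f|_{\hat\sigma}$ denotes the homogenization of $f|_\sigma$ to a common degree $d\ge\max_\sigma\deg f|_\sigma$: $\hat f|_{\hat\sigma}=x_0^d\,f|_\sigma(x_1/x_0,\dots,x_n/x_0)$. *)

(* Defs.v *)
From mathcomp Require Import all_boot all_order all_algebra.
From mathcomp Require Import finmap.
From mathcomp Require Import boolp classical_sets reals topology normedtype derive.
(* The notations of mpoly cannot be declared together with those of topology;
   the few that are needed are redeclared below, at compatible levels. *)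
From mathcomp Require Import -(notations) mpoly.
Import GRing.Theory Num.Theory numFieldNormedType.Exports.

Set Implicit Arguments.
Unset Strict Implicit.
Unset Printing Implicit Defensive.

Local Open Scope classical_set_scope.
Local Open Scope ring_scope.

Notation "{ 'mpoly' R [ n ] }" := (mpoly n R)
  (at level 0, R at level 1, n at level 1, format "{ 'mpoly'  R [ n ] }")
  : type_scope.
Notation "p .@[ v ]" := (meval v p)
  (at level 1, left associativity, format "p .@[ v ]") : ring_scope.
Notation msize p := (mmeasure mdeg p).

Section Ideals.
Variable A : comNzRingType.

Definition ideal_gen (G : set A) : set A :=
  [set x | exists2 cs : seq (A * A),
     (forall cg, cg \in cs -> G cg.2) & x = \sum_(cg <- cs) cg.1 * cg.2].

Definition ideal_pow (I : set A) (k : nat) : set A :=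
  ideal_gen [set x | exists2 g : 'I_k -> A,
     (forall j, I (g j)) & x = \prod_(j < k) g j].

End Ideals.

Section Polynomials.
Variables (R : realType) (n : nat).
Implicit Type p : {mpoly R[n]}.

(* x_0^d p(x_1/x_0, ..., x_n/x_0), with x_0 the variable of index ord0;
   meaningful only when d is at least the degree of p. *)
Definition homogenize (d : nat) p : {mpoly R[n.+1]} :=
  \sum_(m <- msupp p)
    mcoeff m p *: (mpolyX R (mnm1 ord0) ^+ (d - mdeg m) *
             \prod_(j < n) mpolyX R (mnm1 (lift ord0 j)) ^+ m j).

(* msize p is 1 + the degree of p, and 0 if p = 0. *)
Definition homogenized_ideal (I : set {mpoly R[n]}) : set {mpoly R[n.+1]} :=
  ideal_gen [set homogenize (msize p).-1 p | p in I].

Definition vanishing_ideal (X : set 'rV[R]_n) : set {mpoly R[n]} :=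
  [set p | forall x, X x -> p.@[x ord0] = 0].

End Polynomials.

Section SmoothFunctions.
Variables (R : realType) (n : nat).
Implicit Types (A U : set 'rV[R]_n) (g : 'rV[R]_n -> R).

Fixpoint Ck_on_open (k : nat) U g : Prop :=
  (forall x, U x -> {for x, continuous g}) /\
  if k is k'.+1 then
    forall j : 'I_n,
      (forall x, U x -> derivable g x (delta_mx ord0 j)) /\
      Ck_on_open k' U (fun x => 'D_(delta_mx ord0 j) g x)
  else True.

(* On a set that need not be open, C^k means: extends to a C^k function on an
   open neighbourhood. *)
Definition Ck_on (k : nat) A g : Prop :=
  exists U, [/\ open U, A `<=` U &
    exists2 h : 'rV[R]_n -> R,
      Ck_on_open k U h & forall x, A x -> h x = g x].

End SmoothFunctions.

Section Complexes.
Variables (R : realType) (n : nat).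

(* A simplex is given by the finite set of its vertices; its set of points is
   the convex hull of this set. *)
Notation simplex := {fset 'rV[R]_n}.
Implicit Types (D : {fset simplex}) (s t : simplex).

Definition hull s : set 'rV[R]_n :=
  [set x | exists c : 'rV[R]_n -> R,
     [/\ forall v, v \in s -> 0 <= c v,
         \sum_(v <- s) c v = 1 &
         x = \sum_(v <- s) c v *: v]].

Definition affinely_independent s : Prop :=
  forall c : 'rV[R]_n -> R,
    \sum_(v <- s) c v = 0 -> \sum_(v <- s) c v *: v = 0 ->
    forall v, v \in s -> c v = 0.

(* The empty set is not counted as a face; hull fset0 is empty, so disjoint
   simplices are allowed by the last axiom, and two simplices that meet do so
   in the face spanned by their common vertices. *)
Record simplicial_complex D : Prop := SimplicialComplex {
  face_nonempty : forall s, s \in D -> s != fset0;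
  face_independent : forall s, s \in D -> affinely_independent s;
  face_subset : forall s t, s \in D -> (t `<=` s)%fset -> t != fset0 -> t \in D;
  face_meet : forall s t, s \in D -> t \in D ->
    hull s `&` hull t = hull (s `&` t)%fset }.

Definition faces D (j : nat) : {fset simplex} :=
  [fset s in D | #|` s| == j.+1]%fset.

Definition polyhedron D : set 'rV[R]_n :=
  [set x | exists2 s, s \in D & hull s x].

Definition boundary (A : set 'rV[R]_n) : set 'rV[R]_n :=
  closure A `\` interior A.

Definition interior_faces D (j : nat) : set simplex :=
  [set s | s \in faces D j /\ ~ (hull s `<=` boundary (polyhedron D))].

Definition has_dimension D (d : nat) : Prop :=
  (exists s, s \in faces D d) /\ (forall s, s \in D -> (#|` s| <= d.+1)%N).

Definition pure D : Prop :=
  forall s, s \in D -> (forall t, t \in D -> (s `<=` t)%fset -> t = s) ->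
    s \in faces D n.

Definition hereditary D : Prop :=
  forall s s', s \in faces D n -> s' \in faces D n -> (s `&` s')%fset \in D ->
    exists (m : nat) (c : nat -> simplex),
      [/\ c 0%N = s, c m = s',
          forall k, (k <= m)%N -> c k \in faces D n /\ (s `&` s' `<=` c k)%fset &
          forall k, (k < m)%N -> interior_faces D n.-1 (c k `&` c k.+1)%fset].

Definition star D t : set 'rV[R]_n :=
  [set x | exists s, [/\ s \in faces D n, (t `<=` s)%fset & hull s x]].

(* Families indexed by faces are functions on all simplices, of which only the
   values at the relevant faces are used. *)
Variables (D : {fset simplex}) (i : nat) (r s : simplex -> nat).

Definition spline_space : set (simplex -> {mpoly R[n]}) :=
  [set f | exists F : 'rV[R]_n -> R,
    [/\ forall sg, sg \in faces D n ->
          forall x, hull sg x -> F x = (f sg).@[x ord0],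
        {within polyhedron D, continuous F},
        forall tau, interior_faces D n.-1 tau -> Ck_on (r tau) (star D tau) F &
        forall beta sg sg', beta \in faces D i ->
          sg \in faces D n -> sg' \in faces D n ->
          (beta `<=` sg)%fset -> (beta `<=` sg')%fset ->
          forall m : multinom n, (mdeg m <= s beta)%N ->
          forall x, hull beta x ->
            (mderivm m (f sg)).@[x ord0] = (mderivm m (f sg')).@[x ord0]]].

Variable ell : simplex -> {mpoly R[n]}.

Definition Jcheck (tau : simplex) : set {mpoly R[n]} :=
  ideal_gen [set ell tau ^+ (r tau).+1] `&`
  \bigcap_(beta in [set b | b \in faces D i /\ (b `<=` tau)%fset])
    ideal_pow (vanishing_ideal (hull beta)) (s beta).+1.

Definition Jhom (tau : simplex) : set {mpoly R[n.+1]} :=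
  ideal_gen [set homogenize 1 (ell tau) ^+ (r tau).+1] `&`
  \bigcap_(beta in [set b | b \in faces D i /\ (b `<=` tau)%fset])
    ideal_pow (homogenized_ideal (vanishing_ideal (hull beta))) (s beta).+1.

End Complexes.

(* Main.v *)
(** Continuity of the derivatives up to order k on a simplex, which is the
closure of its interior, turns smoothness conditions on [f] into vanishing of
derivatives of [p = f|_sg - f|_sg'] on a face. Let [pi] be an affine projection
onto the affine span of that face, and let [Y_j] be the homogenizations of the
coordinates of [x - pi x]. The Euler field [sum_j Y_j d/dx_j] acts on
[(Y)^k / (Y)^(k+1)] as multiplication by [k] and homogenization commutes with
the [d/dx_j], so by induction the homogenization of [p] lies in [(Y)^(k+1)] as
soon as all derivatives of [p] of order at most [k] vanish on the face; no
degree bookkeeping is needed. For a facet each [Y_j] is a multiple of the linear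
form of that facet. Setting [x_0 = 1] gives back [p].

Conversely, the differences vanish along the chains provided by heredity, so the
pieces glue. Barycentric coordinates show that an interior facet has at most
one [n]-simplex on each side, and [p + l_+^(k+1) a] is of class [C^k]. *)

Require Import Defs.
From mathcomp Require Import all_boot all_order all_algebra.
From mathcomp Require Import finmap.
From HB Require Import structures.
From mathcomp Require Import ssrcomplements functions ring zify.
From mathcomp Require Import boolp classical_sets reals topology normedtype derive.
From mathcomp Require Import -(notations) mpoly.
Import Order.TTheory GRing.Theory Num.Theory numFieldNormedType.Exports.

Set Implicit Arguments.
Unset Strict Implicit.
Unset Printing Implicit Defensive.

Local Open Scope classical_set_scope.
Local Open Scope ring_scope.

(** * Ideals and polynomial functions *)

Section IdealTheory.
Variable A : comNzRingType.
Implicit Types (G : set A) (k : nat).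

Lemma ideal_gen_ind G (P : A -> Prop) :
  P 0 -> (forall x y, P x -> P y -> P (x + y)) ->
  (forall a g, G g -> P (a * g)) -> ideal_gen G `<=` P.
Proof.
move=> P0 PD PM x [cs Gcs ->].
elim: cs Gcs => [|c cs IH] Gcs; first by rewrite big_nil.
rewrite big_cons; apply: PD; first by apply/PM/Gcs/mem_head.
by apply: IH => cg cg_cs; apply: Gcs; rewrite in_cons cg_cs orbT.
Qed.

Lemma ideal_gen0 G : ideal_gen G 0.
Proof. by exists [::]; rewrite ?big_nil. Qed.

Lemma ideal_genD G x y : ideal_gen G x -> ideal_gen G y -> ideal_gen G (x + y).
Proof.
move=> [cs Gcs ->] [ds Gds ->]; exists (cs ++ ds); last by rewrite big_cat.
by move=> cg; rewrite mem_cat => /orP[/Gcs|/Gds].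
Qed.

Lemma ideal_genM G a x : ideal_gen G x -> ideal_gen G (a * x).
Proof.
move=> [cs Gcs ->]; exists [seq (a * c.1, c.2) | c <- cs].
  by move=> _ /mapP[c /Gcs Gc ->].
by rewrite big_map mulr_sumr; apply: eq_bigr => c _; rewrite mulrA.
Qed.

Lemma ideal_genB G x y : ideal_gen G x -> ideal_gen G y -> ideal_gen G (x - y).
Proof. by move=> Gx Gy; rewrite -mulN1r; apply/ideal_genD/ideal_genM. Qed.

Lemma ideal_gen_sum G I (r : seq I) (P : pred I) F :
  (forall i, P i -> ideal_gen G (F i)) -> ideal_gen G (\sum_(i <- r | P i) F i).
Proof.
by move=> GF; apply: big_ind => //; [exact: ideal_gen0|exact: ideal_genD].
Qed.

Lemma sub_ideal_gen G : G `<=` ideal_gen G.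
Proof.
move=> x Gx; exists [:: (1, x)]; last by rewrite big_seq1 mul1r.
by move=> c; rewrite inE => /eqP ->.
Qed.

Lemma ideal_gen1P (a x : A) : ideal_gen [set a] x -> exists c, x = c * a.
Proof.
move: x; apply: ideal_gen_ind => [|_ _ [c ->] [d ->]|b _ ->].
- by exists 0; rewrite mul0r.
- by exists (c + d); rewrite mulrDl.
- by exists b.
Qed.

(** [G] may be a mere generating set: [ideal_pow G k] is the [k]-th power of the ideal it generates,
    and the unit ideal for [k = 0]. *)
Lemma ideal_pow_prod G k (g : 'I_k -> A) a :
  (forall j, G (g j)) -> ideal_pow G k (a * \prod_(j < k) g j).
Proof. by move=> Gg; apply/ideal_genM/sub_ideal_gen; exists g. Qed.

Lemma ideal_powS G k g x : G g -> ideal_pow G k x -> ideal_pow G k.+1 (g * x).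
Proof.
move=> Gg; move: x; apply: ideal_gen_ind.
- by rewrite mulr0; apply: ideal_gen0.
- by move=> x y ? ?; rewrite mulrDr; apply: ideal_genD.
move=> a _ [h Gh ->]; rewrite mulrCA.
pose h' j := if unlift ord0 j is Some j' then h j' else g.
rewrite (_ : g * _ = \prod_(j < k.+1) h' j); last first.
  rewrite big_ord_recl /h' unlift_none; congr (_ * _).
  by apply: eq_bigr => j _; rewrite liftK.
apply: ideal_pow_prod => j; rewrite /h'.
by case: unliftP.
Qed.

Lemma ideal_pow1 G x : ideal_gen G x -> ideal_pow G 1 x.
Proof.
move: x; apply: ideal_gen_ind; [exact: ideal_gen0|exact: ideal_genD|].
move=> a g Gg; apply: ideal_genM; apply: sub_ideal_gen.
by exists (fun=> g) => //; rewrite big_ord1.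
Qed.

(** A product of [k] multiples of [a] is a multiple of [a ^+ k]. For a facet this turns a power of
    the ideal of the Y_j into a power of one linear form. *)
Lemma ideal_pow_principal G (a x : A) k :
  (forall g, G g -> exists c, g = c * a) -> ideal_pow G k x ->
  ideal_gen [set a ^+ k] x.
Proof.
move=> Ga; move: x; apply: ideal_gen_ind; [exact: ideal_gen0|exact: ideal_genD|].
move=> b _ [g Gg ->]; apply: ideal_genM.
suff [c ->] : exists c, \prod_(j < k) g j = c * a ^+ k.
  by apply/ideal_genM/sub_ideal_gen.
elim: k g Gg => [|k IH] g Gg; first by exists 1; rewrite big_ord0 mul1r.
rewrite big_ord_recl; have [j|d ->] := IH (fun j => g (lift ord0 j)) _.
  exact: Gg.
by have [c cE] := Ga _ (Gg ord0); exists (c * d); rewrite cE exprS mulrACA.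
Qed.

End IdealTheory.

Section IdealMorphism.
Variables (A B : comNzRingType) (phi : {rmorphism A -> B}).
Implicit Types (G : set A) (H : set B).

Lemma ideal_gen_morph G H x :
  (forall g, G g -> ideal_gen H (phi g)) -> ideal_gen G x ->
  ideal_gen H (phi x).
Proof.
move=> GH; move: x; apply: (@ideal_gen_ind _ _ (fun x => ideal_gen H (phi x))).
- by rewrite rmorph0; apply: ideal_gen0.
- by move=> x y ? ?; rewrite rmorphD; apply: ideal_genD.
- by move=> a g /GH ?; rewrite rmorphM; apply: ideal_genM.
Qed.

Lemma ideal_pow_morph G H k x :
  (forall g, G g -> H (phi g)) -> ideal_pow G k x -> ideal_pow H k (phi x).
Proof.
move=> GH; apply: ideal_gen_morph => _ [h Gh ->]; rewrite rmorph_prod.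
by apply: sub_ideal_gen; exists (phi \o h) => // j; apply: GH.
Qed.

End IdealMorphism.

(** * Polynomials as functions: derivatives, affine polynomials, restriction to lines *)

Section PolynomialFunctions.
Variables (R : realType) (n : nat).
Implicit Types (p q : {mpoly R[n]}) (x y : 'rV[R]_n).

Lemma mpoly_alg_ind (P : {mpoly R[n]} -> Prop) :
  (forall c, P (mpolyC n c)) -> (forall j, P (mpolyX R (mnm1 j))) ->
  (forall p q, P p -> P q -> P (p + q)) ->
  (forall p q, P p -> P q -> P (p * q)) -> forall p, P p.
Proof.
move=> PC PX PD PM; have P1 : P 1 by rewrite -mpolyC1; apply: PC.
have Pexp p k : P p -> P (p ^+ k).
  by move=> Pp; elim: k => // k IH; rewrite exprS; apply: PM.
elim/mpolyind => [|c m p _ _ Pp]; first by rewrite -(mpolyC0 n R); apply: PC.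
apply: PD => //; rewrite -mul_mpolyC; apply: (PM) => //.
by rewrite mpolyXE_id; apply: big_ind => [|p1 p2|j _]; [|exact: PM|exact: Pexp].
Qed.

Lemma continuous_meval p : continuous (fun x => p.@[x ord0] : R).
Proof.
move: p; apply: mpoly_alg_ind => [c|j|p q IHp IHq|p q IHp IHq] x.
- rewrite (_ : (fun _ => _) = cst c); first exact: cst_continuous.
  by apply/funext => y; rewrite mevalC.
- rewrite (_ : (fun _ => _) = fun y : 'rV[R]_n => y ord0 j).
    exact: coord_continuous.
  by apply/funext => y; rewrite mevalXU.
- rewrite (_ : (fun _ => _) = (fun y : 'rV_n => p.@[y ord0]) +
    (fun y : 'rV_n => q.@[y ord0])).
    exact: cvgD (IHp x) (IHq x).
  by apply/funext => y; rewrite mevalD.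
- rewrite (_ : (fun _ => _) = (fun y : 'rV_n => p.@[y ord0]) *
    (fun y : 'rV_n => q.@[y ord0])).
    exact: cvgM (IHp x) (IHq x).
  by apply/funext => y; rewrite mevalM.
Qed.

Lemma is_derive_meval p x j :
  is_derive x (delta_mx ord0 j) (fun x => p.@[x ord0] : R)
    (mderiv j p).@[x ord0].
Proof.
move: p; apply: mpoly_alg_ind => [c|k|p q IHp IHq|p q IHp IHq].
- rewrite (_ : (fun _ => _) = cst c) ?mderivC ?meval0; last first.
    by apply/funext => y; rewrite mevalC.
  exact: is_derive_cst.
- rewrite (_ : (fun _ => _) = fun y : 'rV[R]_n => y ord0 k); last first.
    by apply/funext => y; rewrite mevalXU.
  have <- : (delta_mx ord0 j : 'rV[R]_n) ord0 k
      = (mderiv j (mpolyX R (mnm1 k))).@[x ord0].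
    rewrite mderivX mnm1E mxE eqxx /= eq_sym; case: eqVneq => [->|_].
      by rewrite -mul_mpolyC mevalM mevalC mul1r -{1}[mnm1 _]add0m addmK
                 mpolyX0 meval1.
    by rewrite scale0r meval0.
  apply: DeriveDef; first exact/diff_derivable/differentiable_coord.
  apply: cvg_lim => //; apply: cvg_near_cst.
  near=> h; rewrite /= !mxE addrK /GRing.scale /= mulrA mulVf ?mul1r //.
  by near: h; exact: nbhs_dnbhs_neq.
- rewrite (_ : (fun _ => _) = (fun y : 'rV_n => p.@[y ord0]) +
    (fun y : 'rV_n => q.@[y ord0])); last first.
    by apply/funext => y; rewrite mevalD.
  rewrite mderivD mevalD.
  exact: is_deriveD.
- rewrite (_ : (fun _ => _) = (fun y : 'rV_n => p.@[y ord0]) *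
    (fun y : 'rV_n => q.@[y ord0])); last first.
    by apply/funext => y; rewrite mevalM.
  rewrite mderivM mevalD !mevalM.
  apply: is_derive_eq; rewrite /GRing.scale /= addrC; congr (_ + _).
  by rewrite mulrC.
Unshelve. all: by end_near. Qed.

Lemma derive_meval p x j :
  'D_(delta_mx ord0 j) (fun y : 'rV_n => p.@[y ord0] : R) x =
  (mderiv j p).@[x ord0].
Proof. by have D := is_derive_meval p x j; apply: derive_val. Qed.

Lemma mdeg_succ (m : multinom n) k : mdeg m = k.+1 ->
  exists j m', m = mnm_add (mnm1 j) m' /\ mdeg m' = k.
Proof.
move=> mS; have [j mj] : exists j, m j != 0%N.
  apply/existsP; apply: contra_eqT mS => /existsPn m0.
  by rewrite mdegE big1 // => j _; apply/eqP; rewrite -[_ == _]negbK.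
have mE : m = mnm_add (mnm1 j) (mnm_sub m (mnm1 j)).
  by rewrite addmC submK // lep1mP.
exists j, (mnm_sub m (mnm1 j)); split=> //.
by move: mS; rewrite {1}mE mdegD mdeg1 add1n => /succn_inj.
Qed.

Lemma mderivm_vanish p m :
  (forall x, p.@[x ord0] = 0) -> forall x, (mderivm m p).@[x ord0] = 0.
Proof.
move=> p0; elim: {m}(mdeg m) {-2}m (erefl (mdeg m)) p p0 => [|k IH] m.
  by move=> /eqP; rewrite mdeg_eq0 => /eqP -> p; rewrite mderivm0m.
move=> /mdeg_succ[j [m' [-> m'k]]] p p0; rewrite mderivmDm mderivmU1m.
apply: IH => // x.
have <- : 'D_(delta_mx ord0 j) (fun y : 'rV_n => p.@[y ord0]) x
    = (mderiv j p).@[x ord0] by rewrite -derive_meval.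
rewrite (_ : (fun _ => _) = cst 0) ?derive_cst //.
by apply/funext => y; rewrite p0.
Qed.

Lemma meval0_mcoeff p : p.@[(0 : 'rV[R]_n) ord0] = mcoeff mnm0 p.
Proof.
move: p; apply: mpoly_alg_ind => [c|j|p q IHp IHq|p q IHp IHq].
- by rewrite mevalC mpolyCK.
- by rewrite mevalXU mxE mcoeffX mnm1_eq0.
- by rewrite mevalD IHp IHq mcoeffD.
- by rewrite mevalM IHp IHq rmorphM.
Qed.

(** The value at the origin of the derivative of index [m] is the coefficient of [m] times a product
    of factorials, nonzero in characteristic zero. *)
Lemma meval_eq0 p : (forall x, p.@[x ord0] = 0) -> p = 0.
Proof.
move=> p0; apply/mpolyP => m; rewrite mcoeff0.
have := mderivm_vanish m p0 0; rewrite meval0_mcoeff mcoeff_mderivm addm0.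
move=> /eqP; rewrite -mulr_natr mulf_eq0 pnatr_eq0 => /orP[/eqP //|].
rewrite eqn0Ngt => /negP[]; apply: prodn_gt0 => i.
by rewrite ffactnn fact_gt0.
Qed.

Lemma msize_le2 p : (msize p <= 2)%N ->
  p = mpolyC n (mcoeff mnm0 p) +
      \sum_j mcoeff (mnm1 j) p *: mpolyX R (mnm1 j).
Proof.
move=> p2; apply/mpolyP => m; rewrite mcoeffD mcoeffC raddf_sum /=.
have [m0|[]] : m = mnm0 \/ (exists j, m = mnm1 j) \/ (1 < mdeg m)%N.
- case E : (mdeg m) => [|[|k]]; [left|right; left|right; right] => //.
    by apply/eqP; rewrite -mdeg_eq0 E.
  by have /mdeg1P[j /eqP ->] : mdeg m == 1%N by [rewrite E]; exists j.
- rewrite m0 eqxx mulr1 big1 ?addr0 // => j _.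
  by rewrite mcoeffZ mcoeffX mnm1_eq0 mulr0.
- move=> [j ->]; rewrite mnm1_eq0 mulr0 add0r (bigD1 j) //= big1 => [|k kj].
    by rewrite addr0 mcoeffZ mcoeffX eqxx mulr1.
  by rewrite mcoeffZ mcoeffX eq_mnm1 (negbTE kj) mulr0.
- move=> m2; rewrite memN_msupp_eq0; last first.
    by apply: msize_mdeg_ge; apply: leq_trans p2 _.
  rewrite -mdeg_eq0 gtn_eqF ?mulr0 ?add0r; last exact: ltn_trans m2.
  rewrite big1 // => j _; rewrite mcoeffZ mcoeffX.
  by case: eqVneq m2 => [<-|_ _]; rewrite ?mdeg1 ?mulr0.
Qed.

Lemma meval_affine (I : eqType) (t : seq I) p (c : I -> R)
    (y : I -> 'rV[R]_n) : (msize p <= 2)%N -> \sum_(i <- t) c i = 1 ->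
  p.@[(\sum_(i <- t) c i *: y i) ord0] = \sum_(i <- t) c i * p.@[y i ord0].
Proof.
have evE x : (msize p <= 2)%N ->
    p.@[x ord0] = mcoeff mnm0 p + \sum_j mcoeff (mnm1 j) p * x ord0 j.
  move=> p2; rewrite {1}[p]msize_le2 // mevalD mevalC raddf_sum /=.
  by congr (_ + _); apply: eq_bigr => j _; rewrite mevalZ mevalXU.
move=> p2 c1; rewrite evE //.
under [RHS]eq_bigr do rewrite evE // mulrDr.
rewrite big_split /= -mulr_suml c1 mul1r; congr (_ + _).
under [RHS]eq_bigr do rewrite mulr_sumr.
rewrite exchange_big /=; apply: eq_bigr => j _.
rewrite summxE mulr_sumr; apply: eq_bigr => i _.
by rewrite mxE mulrCA.
Qed.

(** On the line through [x] and [y] the polynomial becomes a univariate [u] with too many roots, so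
    [u = 0]; its value at 1 is the value at [y]. *)
Lemma meval_segment p x y (e : R) : 0 < e ->
  (forall t, 0 <= t <= e -> p.@[(x + t *: (y - x)) ord0] = 0) ->
  p.@[y ord0] = 0.
Proof.
move=> e0 p0.
have [u uE] : exists u : {poly R},
    forall t, u.[t] = p.@[(x + t *: (y - x)) ord0].
  move: p {p0}; apply: mpoly_alg_ind => [c|j|p q [u IHp] [v IHq]|p q [u IHp] [v IHq]].
  - by exists c%:P => t; rewrite hornerC mevalC.
  - exists ((x ord0 j)%:P + ((y - x) ord0 j)%:P * 'X) => t.
    by rewrite mevalXU !hornerE !mxE [_ * t]mulrC.
  - by exists (u + v) => t; rewrite mevalD hornerD IHp IHq.
  - by exists (u * v) => t; rewrite mevalM hornerM IHp IHq.
have u0 : u = 0.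
  apply/eqP; apply: contraT => un0.
  (* The numbers e, e/2, e/3, ..., as many as [size u], are distinct roots in the interval; a
     nonzero [u] has fewer. *)
  pose rs := [seq e / k.+1%:R | k <- iota 0 (size u)].
  have := @max_poly_roots _ u rs un0; rewrite size_map size_iota ltnn => -> //.
    apply/allP => _ /mapP[k _ ->]; rewrite rootE uE p0 //.
    have e0' := ltW e0; apply/andP; split; first exact: divr_ge0.
    by rewrite ler_pdivrMr ?ltr0n // ler_peMr // ler1n.
  rewrite map_inj_uniq ?iota_uniq // => k l /(mulfI (lt0r_neq0 e0)) /invr_inj.
  by move/eqP; rewrite eqr_nat => /eqP[].
have := uE 1; rewrite u0 horner0 scale1r addrC subrK => <-.
by [].
Qed.

End PolynomialFunctions.

(** * Homogenization *)

Lemma mderivXn (A : comNzRingType) k (i : 'I_k) (p : {mpoly A[k]}) e :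
  mderiv i (p ^+ e) = e%:R *: (p ^+ e.-1 * mderiv i p).
Proof.
elim: e => [|e IH]; first by rewrite expr0 -mpolyC1 mderivC scale0r.
rewrite exprS mderivM IH; case: e {IH} => [|e] /=.
  by rewrite scale0r mulr0 addr0 expr0 mulr1 mul1r scale1r.
by rewrite -scalerAr mulrA -exprS mulrC -[X in X + _]scale1r -scalerDl nat1r.
Qed.

Section Homogenize.
Variables (R : realType) (n : nat).
Implicit Types (p q : {mpoly R[n]}) (d : nat).

Notation x0 := (mpolyX R (mnm1 (ord0 : 'I_n.+1))).
Notation xS j := (mpolyX R (mnm1 (lift (ord0 : 'I_n.+1) j))).

Definition homogenized_monomial d (m : multinom n) : {mpoly R[n.+1]} :=
  x0 ^+ (d - mdeg m) * \prod_(j < n) xS j ^+ m j.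

(** Summing over all monomials of degree below a common [k], instead of the support, puts several
    polynomials on one index set; linearity is then termwise. *)
Lemma homogenizewE d p k : (msize p <= k)%N ->
  homogenize d p =
  \sum_(m : bmultinom n k) mcoeff m p *: homogenized_monomial d m.
Proof.
move=> pk; rewrite /homogenize (big_mksub (bmultinom n k)) /=; first last.
- by move=> x /msize_mdeg_lt /leq_trans; apply.
- exact: msupp_uniq.
by rewrite big_rmcond //= => m /memN_msupp_eq0 ->; rewrite scale0r.
Qed.

Lemma homogenize_is_linear d : linear (homogenize d : {mpoly R[n]} -> _).
Proof.
move=> c p q; pose k := maxn (msize (c *: p + q)) (maxn (msize p) (msize q)).
rewrite !(@homogenizewE _ _ k) ?leq_max ?leqnn ?orbT //.
rewrite scaler_sumr -big_split; apply: eq_bigr => m _ /=.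
by rewrite mcoeffD mcoeffZ scalerDl scalerA.
Qed.

HB.instance Definition _ d :=
  GRing.isLinear.Build R {mpoly R[n]} {mpoly R[n.+1]} _ (homogenize d)
    (homogenize_is_linear d).

Lemma homogenizeX d m :
  homogenize d (mpolyX R m) = homogenized_monomial d m.
Proof. by rewrite /homogenize msuppX big_seq1 mcoeffX eqxx scale1r. Qed.

Lemma homogenizeE d p : homogenize d p =
  \sum_(m <- msupp p) mcoeff m p *: homogenized_monomial d m.
Proof. by []. Qed.

Lemma homogenize1C c : homogenize 1 (mpolyC n c) = c *: x0.
Proof.
have -> : mpolyC n c = c *: mpolyX R mnm0 by rewrite mpolyX0 alg_mpolyC.
rewrite linearZ /= homogenizeX /homogenized_monomial mdeg0 big1 ?mulr1 // => j _.
by rewrite mnm0E.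
Qed.

Lemma homogenize1X j : homogenize 1 (mpolyX R (mnm1 j)) = xS j.
Proof.
rewrite homogenizeX /homogenized_monomial mdeg1 subnn mul1r (bigD1 j) //=.
rewrite mnm1E eqxx big1 ?mulr1 // => k kj.
by rewrite mnm1E eq_sym (negbTE kj).
Qed.

Lemma mderiv_xS (j k : 'I_n) : mderiv (lift ord0 j) (xS k) = (k == j)%:R.
Proof.
rewrite mderivX mnm1E (inj_eq lift_inj); case: eqVneq => [->|_].
  by rewrite -{1}[mnm1 _]add0m addmK mpolyX0 scale1r.
by rewrite scale0r.
Qed.

Lemma mderiv_x0 (j : 'I_n) : mderiv (lift ord0 j) x0 = 0.
Proof. by rewrite mderivX mnm1E scale0r. Qed.

(** Differentiation lowers the degree of a monomial and the target degree by one, so the exponent of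
    x_0 stays. With truncated subtraction this is true for every [d]. *)
Lemma mderiv_homogenize d (j : 'I_n) p :
  mderiv (lift ord0 j) (homogenize d p) = homogenize d.-1 (mderiv j p).
Proof.
rewrite homogenizeE linear_sum [mderiv j p]/mderiv linear_sum /=.
apply: eq_bigr => m _; rewrite !linearZ /= mulrC -scalerA; congr (_ *: _).
rewrite homogenizeX /homogenized_monomial mderivM mderivXn mderiv_x0.
rewrite mulr0 scaler0 mul0r add0r.
rewrite (bigD1 j) //= mderivM mderivXn mderiv_xS eqxx mulr1.
have -> : mderiv (lift ord0 j) (\prod_(i < n | i != j) xS i ^+ m i) = 0.
  apply: (big_ind (fun q : {mpoly R[n.+1]} => mderiv (lift ord0 j) q = 0)).
  - by rewrite -mpolyC1 mderivC.
  - by move=> q1 q2 q10 q20; rewrite mderivM q10 q20 mul0r mulr0 addr0.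
  - by move=> i ij; rewrite mderivXn mderiv_xS (negbTE ij) mulr0 scaler0.
rewrite mulr0 addr0 -scalerAl -scalerAr.
case: (posnP (m j)) => [->|mj]; first by rewrite !scale0r.
congr (_ *: _); rewrite [in RHS](bigD1 j) //= mnmBE mnm1E eqxx subn1.
congr (_ ^+ _ * (_ * _)); last first.
  apply: eq_bigr => i ij; rewrite mnmBE mnm1E eq_sym (negbTE ij) subn0 //.
have : (mdeg (mnm_sub m (mnm1 j))).+1 = mdeg m.
  by rewrite -[in RHS](@submK _ (mnm1 j) m) ?lep1mP -?lt0n // mdegD mdeg1 addn1.
by move=> <-; rewrite -subn1 -subnDA add1n.
Qed.

Definition dehomogenize : {mpoly R[n.+1]} -> {mpoly R[n]} :=
  comp_mpoly [tuple if unlift ord0 i is Some j then mpolyX R (mnm1 j) else 1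
             | i < n.+1].

HB.instance Definition _ := GRing.RMorphism.on dehomogenize.

Lemma homogenizeK d p : dehomogenize (homogenize d p) = p.
Proof.
rewrite /dehomogenize homogenizeE raddf_sum [RHS]mpolyE; apply: eq_bigr => m _ /=.
rewrite comp_mpolyZ; congr (_ *: _); rewrite mpolyXE_id.
rewrite rmorphM rmorphXn rmorph_prod /=.
rewrite comp_mpolyXU -tnth_nth tnth_mktuple unlift_none expr1n mul1r.
apply: eq_bigr => j _.
by rewrite rmorphXn /= comp_mpolyXU -tnth_nth tnth_mktuple liftK.
Qed.

Lemma meval_homogenize d p (u : 'I_n.+1 -> R) :
  (msize p <= d.+1)%N -> u ord0 != 0 ->
  (homogenize d p).@[u] =
  u ord0 ^+ d * p.@[fun j => u (lift ord0 j) / u ord0].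
Proof.
move=> pd u0; rewrite homogenizeE raddf_sum mevalE mulr_sumr big_seq [RHS]big_seq.
apply: eq_bigr => m /msize_mdeg_lt /leq_trans /(_ pd); rewrite ltnS => md.
rewrite /= mevalZ mulrCA; congr (_ * _).
rewrite mevalM rmorphXn rmorph_prod /= mevalXU.
under [in RHS]eq_bigr do rewrite exprMn exprVn.
rewrite big_split /= prodfV prodrXr -mdegE mulrCA mulrC.
congr (_ * _); first by apply: eq_bigr => j _; rewrite rmorphXn /= mevalXU.
by rewrite -expfB_cond // (negbTE u0).
Qed.

End Homogenize.

(** * The Euler operator of an affine projection *)

Section EulerOperator.
Variables (R : realType) (n : nat) (v : 'rV[R]_n) (N : 'M[R]_n).
Implicit Types (p : {mpoly R[n]}) (P Q : {mpoly R[n.+1]}).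

(** The coordinates of x - pi x, where pi x = [x - (x - v) *m N] is an affine projection once [N] is
    idempotent. [linear_form] gives their homogenizations, the Y_j. *)
Definition affine_form (j : 'I_n) : {mpoly R[n]} :=
  \sum_k N k j *: (mpolyX R (mnm1 k) - mpolyC n (v ord0 k)).

Definition linear_form (j : 'I_n) : {mpoly R[n.+1]} :=
  \sum_k N k j *: (mpolyX R (mnm1 (lift ord0 k)) -
                   v ord0 k *: mpolyX R (mnm1 ord0)).

Lemma meval_affine_form j (x : 'rV[R]_n) :
  (affine_form j).@[x ord0] = ((x - v) *m N) ord0 j.
Proof.
rewrite /affine_form raddf_sum mxE; apply: eq_bigr => k _ /=.
by rewrite mevalZ mevalB mevalXU mevalC !mxE mulrC.
Qed.

Lemma msize_affine_form j : (msize (affine_form j) <= 2)%N.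
Proof.
apply: leq_trans (msize_sum _ _ _) _; apply/bigmax_leqP => k _.
apply: leq_trans (msizeZ_le _ _) _; apply: leq_trans (msizeD_le _ _) _.
by rewrite msizeN msizeX mdeg1 msizeC geq_max /=; case: eqP.
Qed.

Lemma homogenize_affine_form j : homogenize 1 (affine_form j) = linear_form j.
Proof.
rewrite /affine_form linear_sum; apply: eq_bigr => k _ /=.
by rewrite linearZ linearB /= homogenize1X homogenize1C.
Qed.

Definition euler Q : {mpoly R[n.+1]} :=
  \sum_j linear_form j * mderiv (lift ord0 j) Q.

Lemma eulerD P Q : euler (P + Q) = euler P + euler Q.
Proof.
by rewrite -big_split; apply: eq_bigr => j _; rewrite mderivD mulrDr.
Qed.

Lemma eulerM P Q : euler (P * Q) = euler P * Q + P * euler Q.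
Proof.
rewrite mulr_suml mulr_sumr -big_split; apply: eq_bigr => j _ /=.
by rewrite mderivM mulrDr; congr (_ + _); [exact: mulrA|exact: mulrCA].
Qed.

Hypothesis NN : N *m N = N.

(** The derivative of Y_k by x_j is the constant [N j k], and the sum over j of [N j k] times Y_j is
    Y_k because [N] is idempotent. *)
Lemma euler_linear_form k : euler (linear_form k) = linear_form k.
Proof.
rewrite /euler [RHS]/linear_form -[in RHS]NN.
have dY j : mderiv (lift ord0 j) (linear_form k) = mpolyC _ (N j k).
  rewrite /linear_form linear_sum (bigD1 j) //= big1 => [|l lj].
    rewrite mderivZ mderivB mderivZ mderiv_x0 mderiv_xS eqxx scaler0 subr0 addr0.
    by rewrite -alg_mpolyC.
  by rewrite mderivZ mderivB mderivZ mderiv_x0 mderiv_xS (negbTE lj) !scaler0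
             subr0 scaler0.
under eq_bigr do rewrite dY mulrC mul_mpolyC /linear_form scaler_sumr.
rewrite exchange_big; apply: eq_bigr => l _ /=.
rewrite mxE scaler_suml; apply: eq_bigr => j _.
by rewrite scalerA mulrC.
Qed.

Lemma euler_prod k (g : 'I_k -> {mpoly R[n.+1]}) :
  (forall j, euler (g j) = g j) ->
  euler (\prod_(j < k) g j) = k%:R * \prod_(j < k) g j.
Proof.
elim: k g => [|k IH] g gE.
  rewrite !big_ord0 mul0r /euler big1 // => j _.
  by rewrite -mpolyC1 mderivC mulr0.
rewrite !big_ord_recl eulerM gE IH => [|j]; last exact: gE.
by rewrite mulrCA -[X in X + _]mul1r -mulrDl nat1r.
Qed.

(* The Euler operator acts on I^k / I^(k+1) as multiplication by k. *)
Lemma ideal_pow_euler k Q : ideal_pow (range linear_form) k Q ->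
  ideal_pow (range linear_form) k.+1 (euler Q - k%:R * Q).
Proof.
move: Q; apply: (@ideal_gen_ind _ _ (fun Q => ideal_pow _ _ (euler Q - _ * Q))).
- have -> : euler 0 = 0.
    by rewrite /euler big1 // => j _; rewrite mderiv0 mulr0.
  by rewrite mulr0 subr0; apply: ideal_gen0.
- move=> P Q ? ?; rewrite eulerD mulrDr opprD addrACA; exact: ideal_genD.
move=> a _ [g Gg ->]; rewrite eulerM euler_prod => [|j]; last first.
  by have [i _ <-] := Gg j; apply: euler_linear_form.
(* The Leibniz term with [euler] on the product cancels the multiple by [k]. In what remains, each
   summand of [euler a] supplies one more factor Y_j. *)
rewrite mulrCA addrK mulr_suml; apply: ideal_gen_sum => j _.
by rewrite -mulrA; apply: ideal_powS; [exists j|apply: ideal_pow_prod].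
Qed.

Variable X : set 'rV[R]_n.
Hypothesis X_proj : forall p, vanishing_ideal X p ->
  forall x : 'rV[R]_n, p.@[(x - (x - v) *m N) ord0] = 0.

(** Replacing each x_j by x_j - Y_j changes a polynomial only modulo the Y_j. It turns the
    homogenization of [p] into x_0^d times the value of [p] at a projected point, which is zero by
    [X_proj]. *)
Lemma homogenize_vanish d p : (msize p <= d.+1)%N -> vanishing_ideal X p ->
  ideal_pow (range linear_form) 1 (homogenize d p).
Proof.
move=> pd Xp; apply: ideal_pow1.
pose lq := [tuple if unlift ord0 i is Some j
  then mpolyX R (mnm1 (lift ord0 j)) - linear_form j else mpolyX R (mnm1 ord0)
  | i < n.+1].
have lqE Q : ideal_gen (range linear_form) (Q - comp_mpoly lq Q).
  move: Q; apply: mpoly_alg_ind => [c|i|P Q IP IQ|P Q IP IQ].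
  - by rewrite comp_mpolyC subrr; apply: ideal_gen0.
  - rewrite comp_mpolyXU -tnth_nth tnth_mktuple.
    case: unliftP => [j|] ->; last by rewrite subrr; apply: ideal_gen0.
    by rewrite opprB addrC subrK; apply: sub_ideal_gen; exists j.
  - by rewrite comp_mpolyD opprD addrACA; apply: ideal_genD.
  - rewrite rmorphM /= (_ : _ - _ = Q * (P - comp_mpoly lq P) +
       comp_mpoly lq P * (Q - comp_mpoly lq Q)); last by ring.
    by apply: ideal_genD; apply: ideal_genM.
suff P0 : comp_mpoly lq (homogenize d p) = 0.
  by have := lqE (homogenize d p); rewrite P0 subr0.
(* The factor x_0 takes care of the points with x_0 = 0, where x_j/x_0 makes no sense; it is
   cancelled afterwards, polynomials forming a domain. *)
have : mpolyX R (mnm1 ord0) * comp_mpoly lq (homogenize d p) = 0.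
  apply: meval_eq0 => y; rewrite mevalM mevalXU.
  have [->|y0] := eqVneq (y ord0 ord0) 0; first by rewrite mul0r.
  rewrite comp_mpoly_meval meval_homogenize //=; last first.
    by rewrite tnth_mktuple unlift_none mevalXU.
  pose x : 'rV[R]_n := \row_j (y ord0 (lift ord0 j) / y ord0 ord0).
  rewrite (@meval_eq _ _ _ ((x - (x - v) *m N) ord0)) ?X_proj ?mulr0 // => j.
  rewrite !tnth_mktuple unlift_none liftK mevalXU mevalB mevalXU !mxE mulrBl.
  congr (_ - _); rewrite /linear_form raddf_sum mulr_suml; apply: eq_bigr => k _.
  rewrite /= mevalZ mevalB mevalZ !mevalXU !mxE mulrBr !mulrBl.
  rewrite [v ord0 k * _]mulrC -!mulrA [y ord0 ord0 * _]mulrCA divff // mulr1.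
  by congr (_ - _); rewrite mulrC ?mulrA.
move=> /eqP; rewrite mulf_eq0 => /orP[/eqP X0|/eqP //].
by have := mcoeffXU R (@ord0 n) ord0; rewrite X0 mcoeff0 eqxx => /eqP;
   rewrite eq_sym oner_eq0.
Qed.

(** Induction on [s]. Let P be the homogenization. Its derivatives lie in the power [s.+1], so
    [euler P] lies in the power [s.+2]. P too lies in the power [s.+1], so [euler P] is [s.+1] times
    P modulo the power [s.+2], and [s.+1] is invertible. *)
Lemma homogenize_ideal_pow s d p : (msize p <= d.+1)%N ->
  (forall m, (mdeg m <= s)%N -> vanishing_ideal X (mderivm m p)) ->
  ideal_pow (range linear_form) s.+1 (homogenize d p).
Proof.
elim: s d p => [|s IH] d p pd Xp.
  apply: homogenize_vanish => //.
  by have := Xp mnm0; rewrite mderivm0m; apply; rewrite mdeg0.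
have Pj (j : 'I_n) : ideal_pow (range linear_form) s.+1
    (mderiv (lift ord0 j) (homogenize d p)).
  rewrite mderiv_homogenize; apply: IH => [|m ms].
    rewrite [mderiv j p]/mderiv; apply: leq_trans (msize_sum _ _ _) _.
    apply/bigmax_leqP_seq => m /msize_mdeg_lt mp _.
    have [->|mj] := posnP (m j); first by rewrite mul0r scale0r msize0.
    apply: leq_trans (msizeZ_le _ _) _; rewrite msizeX.
    have : (mdeg (mnm_sub m (mnm1 j))).+1 = mdeg m.
      by rewrite -[in RHS](@submK _ (mnm1 j) m) ?lep1mP -?lt0n // mdegD mdeg1 addn1.
    move=> mE; have := leq_trans mp pd; rewrite -mE.
    by case: (d) => //= e; rewrite ltnS.
  rewrite -mderivmU1m -mderivmDm; apply: Xp.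
  by rewrite mdegD mdeg1; lia.
have Ps : ideal_pow (range linear_form) s.+1 (homogenize d p).
  by apply: IH => // m ms; apply: Xp; rewrite leqW.
have : ideal_pow (range linear_form) s.+2 (euler (homogenize d p)).
  by apply: ideal_gen_sum => j _; apply: ideal_powS => //; exists j.
move=> /ideal_genB /(_ (ideal_pow_euler Ps)); rewrite opprB addrC subrK.
move=> /(@ideal_genM _ _ (mpolyC _ s.+1%:R^-1)).
by rewrite mulrA -mpolyC_nat -mpolyCM mulVf ?pnatr_eq0 // mpolyC1 mul1r.
Qed.

End EulerOperator.

(** * Simplices *)

Section ConvexHulls.
Variables (R : realType) (n : nat).
Implicit Types (s t : {fset 'rV[R]_n}) (p : {mpoly R[n]}) (x y v w : 'rV[R]_n).

Lemma sum_fset_nth (V : nmodType) s m (F : 'rV[R]_n -> V) : #|` s|%fset = m ->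
  \sum_(w <- s) F w = \sum_(k < m) F (nth 0 s k).
Proof. by move=> <-; rewrite (big_nth 0) big_mkord. Qed.

Lemma sum_fset_indicator (V : nmodType) s v (F : 'rV[R]_n -> V) : v \in s ->
  \sum_(w <- s) (if w == v then F w else 0) = F v.
Proof.
move=> vs; rewrite (big_fsetD1 v) //= eqxx big_seq big1 ?addr0 // => w.
by rewrite !inE => /andP[/negbTE ->].
Qed.

Lemma hull_vertex s v : v \in s -> hull s v.
Proof.
move=> vs; exists (fun w => if w == v then 1 else 0); split.
- by move=> w _; case: ifP.
- by rewrite (sum_fset_indicator (fun=> 1)).
- rewrite -[LHS]scale1r -(@sum_fset_indicator _ s v (fun w => 1 *: w)) //.
  by apply: eq_bigr => w _; case: ifP => // _; rewrite scale0r.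
Qed.

Lemma sum_fset_extend (V : nmodType) s t (F : 'rV[R]_n -> V) : (s `<=` t)%fset ->
  \sum_(w <- t) (if w \in s then F w else 0) = \sum_(w <- s) F w.
Proof.
move=> st; rewrite -(big_fset_incl _ st) => [|w _ /negbTE -> //].
by apply: eq_big_seq => w ->.
Qed.

Lemma hull_mono s t : (s `<=` t)%fset -> hull s `<=` hull t.
Proof.
move=> st x [c [c0 c1 ->]]; exists (fun w => if w \in s then c w else 0); split.
- by move=> w _; case: ifP => // /c0.
- by rewrite sum_fset_extend.
- rewrite -(sum_fset_extend (fun w => c w *: w) st); apply: eq_bigr => w _.
  by case: ifP => // _; rewrite scale0r.
Qed.

Lemma hull_convex s x y (e : R) : hull s x -> hull s y -> 0 <= e <= 1 ->
  hull s (x + e *: (y - x)).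
Proof.
move=> [c [c0 c1 ->]] [d [d0 d1 ->]] /andP[e0 e1].
exists (fun w => c w + e * (d w - c w)); split.
- move=> w ws; rewrite mulrBr addrCA -{1}[c w]mul1r -mulrBl.
  by rewrite addr_ge0 ?mulr_ge0 ?subr_ge0 ?c0 ?d0.
- by rewrite big_split /= -mulr_sumr sumrB c1 d1 subrr mulr0 addr0.
- rewrite -sumrB scaler_sumr -big_split; apply: eq_bigr => w _ /=.
  by rewrite scalerDl -scalerA scalerBl.
Qed.

(* Only the initial direction matters at the points of the simplex where a
   coordinate vanishes. *)
Lemma small_step_ge0 (I : eqType) (r : seq I) (a b : I -> R) :
  (forall i, i \in r -> 0 < a i \/ (0 <= a i /\ 0 <= b i)) ->
  exists2 e : R, 0 < e <= 1 &
    forall h, 0 <= h <= e -> forall i, i \in r -> 0 <= a i + h * b i.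
Proof.
elim: r => [|i r IH] ab; first by exists 1; rewrite ?lexx ?ltr01.
have [|e /andP[e0 e1] He] := IH.
  by move=> j jr; apply: ab; rewrite inE jr orbT.
have [d /andP[d0 d1] Hd] : exists2 d : R, 0 < d <= 1 &
    forall h, 0 <= h <= d -> 0 <= a i + h * b i.
  have [ai|[ai bi]] := ab i (mem_head _ _); last first.
    exists 1; rewrite ?lexx ?ltr01 // => h /andP[h0 _].
    by rewrite addr_ge0 // mulr_ge0.
  (* A step h of at most a/(a + |b|) satisfies h|b| <= a, and the denominator is positive even if
     [b i] is zero. *)
  pose m := a i + `|b i|; have m0 : 0 < m by rewrite ltr_pwDl.
  exists (a i / m); first by rewrite divr_gt0 //= ler_pdivrMr // mul1r lerDl.
  move=> h /andP[h0 hm]; rewrite -lerBlDr sub0r -mulrN.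
  suff : h * `|b i| <= a i.
    by apply: le_trans; rewrite ler_wpM2l // -normrN ler_norm.
  have : h * m <= a i by rewrite -ler_pdivlMr.
  by apply: le_trans; rewrite ler_wpM2l // lerDr ltW.
exists (Num.min d e); first by rewrite lt_min d0 e0 ge_min d1.
move=> h /andP[h0]; rewrite le_min => /andP[hd he] j.
rewrite inE => /predU1P[->|jr]; first by apply: Hd; rewrite h0.
by apply: He => //; rewrite h0.
Qed.

(** Near the barycentre, whose coefficients [a] are all positive, the segment towards the given
    affine combination stays in the hull, where [p] vanishes; [meval_segment] carries this to its
    end. *)
Lemma vanish_affine_span s p (c : 'rV[R]_n -> R) : s != fset0 ->
  vanishing_ideal (hull s) p -> \sum_(w <- s) c w = 1 ->
  p.@[(\sum_(w <- s) c w *: w) ord0] = 0.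
Proof.
rewrite -cardfs_gt0 => s0 sp c1; pose a : R := #|` s|%fset%:R^-1.
have a0 : 0 < a by rewrite invr_gt0 ltr0n.
have sa : \sum_(w <- s) a = 1.
  rewrite (@sum_fset_nth _ _ _ (fun=> a) erefl) sumr_const card_ord -mulr_natr.
  by rewrite mulVf // pnatr_eq0 -lt0n.
have [e /andP[e0 _] He] := @small_step_ge0 _ s (fun=> a) (fun w => c w - a)
  (fun w _ => or_introl a0).
apply: (@meval_segment _ _ _ (\sum_(w <- s) a *: w) _ e) => // h h0.
apply: sp; exists (fun w => a + h * (c w - a)); split.
- exact: He.
- by rewrite big_split /= -mulr_sumr sumrB c1 sa subrr mulr0 addr0.
- rewrite -sumrB scaler_sumr -big_split; apply: eq_bigr => w _ /=.
  by rewrite scalerDl -scalerA scalerBl.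
Qed.

Lemma coef_of_row s m (u : 'rV[R]_m) : #|` s|%fset = m ->
  exists c : 'rV[R]_n -> R, forall k : 'I_m, c (nth 0 s k) = u ord0 k.
Proof.
move=> sm; exists (fun w => if insub (index w s) is Some k then u ord0 k else 0).
by move=> k; rewrite index_uniq ?fset_uniq ?sm // valK.
Qed.

(** The rows of [V] span the directions of the affine span of [s], and [E] projects onto their row
    space. So [1%:M - E] kills these directions, and the projection of [x], which is
    [v + (x - v) *m E], lies in the affine span. *)
Lemma affine_projection s : s != fset0 ->
  exists (v : 'rV[R]_n) (N : 'M[R]_n),
  [/\ v \in s, N *m N = N, forall w, hull s w -> (w - v) *m N = 0 &
      forall p, vanishing_ideal (hull s) p ->
        forall x, p.@[(x - (x - v) *m N) ord0] = 0].
Proof.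
move=> s0; have /fset0Pn [v vs] := s0.
pose V := \matrix_(k < #|` s|%fset) (nth 0 s k - v).
pose E := pinvmx V *m V.
have VE : V *m E = V by rewrite mulmxA mulmxKpV.
exists v, (1%:M - E); split => //.
- have EE : E *m E = E by rewrite {1}/E -mulmxA VE.
  by rewrite mulmxBl mul1mx mulmxBr mulmx1 EE subrr subr0.
- move=> _ [c [_ c1 ->]].
  have -> : \sum_(w <- s) c w *: w - v = (\row_(k < #|` s|%fset) c (nth 0 s k)) *m V.
    rewrite mulmx_sum_row -{1}[v]scale1r -c1 scaler_suml -sumrB.
    rewrite (sum_fset_nth _ erefl); apply: eq_bigr => k _.
    by rewrite mxE rowK scalerBr.
  by rewrite mulmxBr mulmx1 -mulmxA VE subrr.
- move=> p sp x.
  have -> : x - (x - v) *m (1%:M - E) = v + (x - v) *m E.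
    rewrite mulmxBr mulmx1; set A := _ *m E; apply/rowP => j; rewrite !mxE; ring.
  rewrite /E mulmxA; set u := _ *m pinvmx V; have [c cE] := coef_of_row u erefl.
  (* The vertex [v] receives the missing weight, so that the coefficients sum to 1. *)
  have -> : v + u *m V =
      \sum_(w <- s) (c w + if w == v then 1 - \sum_(w <- s) c w else 0) *: w.
    rewrite mulmx_sum_row.
    under eq_bigr do rewrite rowK -cE scalerBr.
    rewrite -(sum_fset_nth (fun w => c w *: w - c w *: v) erefl) sumrB -scaler_suml.
    under [RHS]eq_bigr do rewrite scalerDl.
    rewrite big_split /= [X in _ = _ + X](_ : _ = (1 - \sum_(w <- s) c w) *: v).
      by rewrite scalerBl scale1r addrCA addrC -addrA; congr (_ + _); rewrite addrC.
    rewrite -(sum_fset_indicator (fun w => _ *: w) vs); apply: eq_bigr => w _.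
    by case: ifP => // _; rewrite scale0r.
  apply: vanish_affine_span => //; rewrite big_split /=.
  by rewrite (sum_fset_indicator (fun=> _) vs) addrC subrK.
Qed.

(** * Barycentric coordinates of a full-dimensional simplex *)

Section Barycentric.
Variable s : {fset 'rV[R]_n}.
Hypotheses (s_indep : affinely_independent s) (s_card : #|` s|%fset = n.+1).

(** Affine independence makes the square matrix [B] with rows (1, w) invertible; the coordinates of
    [x] are the entries of (1, x) times its inverse. *)
Lemma barycentric_coordinates : exists lam : 'rV[R]_n -> {mpoly R[n]},
  [/\ forall w, (msize (lam w) <= 2)%N,
      forall x, \sum_(w <- s) (lam w).@[x ord0] = 1 &
      forall x, \sum_(w <- s) (lam w).@[x ord0] *: w = x].
Proof.
pose W := \matrix_(k < n.+1) (nth 0 s k).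
pose B : 'M[R]_(n.+1, 1 + n) := row_mx (const_mx 1) W.
have mulB (u : 'rV_n.+1) (c : 'rV[R]_n -> R) :
    (forall k : 'I_n.+1, c (nth 0 s k) = u ord0 k) ->
    u *m B = row_mx (const_mx (\sum_(w <- s) c w)) (\sum_(w <- s) c w *: w).
  move=> cE; rewrite mul_mx_row; congr row_mx.
    apply/rowP => j; rewrite !mxE (sum_fset_nth _ s_card).
    by apply: eq_bigr => k _; rewrite mxE mulr1 cE.
  rewrite mulmx_sum_row (sum_fset_nth _ s_card).
  by apply: eq_bigr => k _; rewrite rowK cE.
have B_unit : (B : 'M_n.+1) \in unitmx.
  rewrite -row_free_unit; apply: inj_row_free => u uB.
  have [c cE] := coef_of_row u s_card.
  have /eq_row_mx[/rowP/(_ ord0)] : row_mx 0 0 = row_mx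
      (const_mx (\sum_(w <- s) c w)) (\sum_(w <- s) c w *: w) :> 'rV_(1 + n).
    by rewrite row_mx0 -(mulB u c cE) uB.
  rewrite !mxE => /esym c0 /esym cw0; apply/rowP => k; rewrite mxE -cE.
  by apply: s_indep => //; rewrite mem_nth // s_card.
pose M : 'M[R]_(1 + n, n.+1) := invmx (B : 'M_n.+1).
pose lamk (k : 'I_n.+1) : {mpoly R[n]} := mpolyC n (M (lshift n ord0) k) +
  \sum_j M (rshift 1 j) k *: mpolyX R (mnm1 j).
have lamkE k (x : 'rV_n) :
    (lamk k).@[x ord0] = (row_mx (const_mx 1) x *m M) ord0 k.
  rewrite mxE big_split_ord /= big_ord1 row_mxEl mxE mul1r mevalD mevalC.
  congr (_ + _); rewrite raddf_sum; apply: eq_bigr => j _ /=.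
  by rewrite row_mxEr mevalZ mevalXU mulrC.
pose lam w := if insub (index w s) is Some k then lamk k else 0.
exists lam; have lamE (x : 'rV_n) :
    row_mx (const_mx 1) x = row_mx (const_mx (\sum_(w <- s) (lam w).@[x ord0]))
      (\sum_(w <- s) (lam w).@[x ord0] *: w) :> 'rV_(1 + n).
  rewrite -(mulB (row_mx (const_mx 1) x *m M)).
    by rewrite -mulmxA /M mulVmx // mulmx1.
  move=> k; rewrite -lamkE /lam index_uniq ?fset_uniq ?s_card // valK //.
split.
- move=> w; rewrite /lam; case: insub => [k|]; last by rewrite msize0.
  apply: leq_trans (msizeD_le _ _) _; rewrite geq_max msizeC.
  rewrite (leq_trans (leq_b1 _)) //=.
  apply: leq_trans (msize_sum _ _ _) _; apply/bigmax_leqP => j _.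
  by apply: leq_trans (msizeZ_le _ _) _; rewrite msizeX mdeg1.
- by move=> x; have /eq_row_mx[/rowP/(_ ord0)] := lamE x; rewrite !mxE.
- by move=> x; have /eq_row_mx[_ <-] := lamE x.
Qed.

Lemma affine_vanish p : (msize p <= 2)%N ->
  (forall w, w \in s -> p.@[w ord0] = 0) -> p = 0.
Proof.
move=> p2 ps; have [lam [_ lam1 lamE]] := barycentric_coordinates.
apply: meval_eq0 => x; rewrite -(lamE x) meval_affine // big_seq big1 // => w ws.
by rewrite ps // mulr0.
Qed.

Variable lam : 'rV[R]_n -> {mpoly R[n]}.
Hypotheses (lam_sum : forall x : 'rV[R]_n, \sum_(w <- s) (lam w).@[x ord0] = 1)
  (lamK : forall x : 'rV[R]_n, \sum_(w <- s) (lam w).@[x ord0] *: w = x).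

Lemma barycentric_unique (c : 'rV[R]_n -> R) w : \sum_(v <- s) c v = 1 ->
  w \in s -> (lam w).@[(\sum_(v <- s) c v *: v) ord0] = c w.
Proof.
move=> c1 ws; set x := \sum_(v <- s) _; apply/eqP; rewrite -subr_eq0; apply/eqP.
apply: (s_indep (c := fun v => (lam v).@[x ord0] - c v)) => //.
  by rewrite sumrB lam_sum c1 subrr.
by under eq_bigr do rewrite scalerBl; rewrite sumrB lamK subrr.
Qed.

Lemma hull_barycentric x :
  hull s x <-> (forall w, w \in s -> 0 <= (lam w).@[x ord0]).
Proof.
split=> [[c [c0 c1 ->]] w ws|lam0]; first by rewrite barycentric_unique ?c0.
by exists (fun w => (lam w).@[x ord0]); split.
Qed.

End Barycentric.

Lemma meval_line p x y (e : R) : (msize p <= 2)%N ->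
  p.@[(x + e *: (y - x)) ord0] = p.@[x ord0] + e * (p.@[y ord0] - p.@[x ord0]).
Proof.
move=> p2.
have := @meval_affine _ _ _ [:: (1 - e, x); (e, y)] p fst snd p2.
rewrite !big_cons !big_nil !addr0 /= subrK => /(_ erefl).
rewrite scalerBl scale1r scalerBr addrA => E.
by rewrite addrAC E; ring.
Qed.

End ConvexHulls.

(** * Piecewise polynomials *)

Lemma near_all_in (T : topologicalType) (I : eqType) (r : seq I)
    (P : I -> T -> Prop) (x : T) :
  (forall i, i \in r -> \forall y \near x, P i y) ->
  \forall y \near x, forall i, i \in r -> P i y.
Proof.
elim: r => [|i r IH] rP; first by near=> y.
have ri : \forall y \near x, P i y by apply: rP; rewrite mem_head.
have rr : \forall y \near x, forall j, j \in r -> P j y.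
  by apply: IH => j jr; apply: rP; rewrite inE jr orbT.
by apply: filterS2 ri rr => y Pi Pr j; rewrite inE => /predU1P[->|/Pr].
Unshelve. all: by end_near. Qed.

Section PiecewiseSmoothness.
Variables (R : realType) (n : nat).
Implicit Types (p q l : {mpoly R[n]}) (x y v : 'rV[R]_n) (f g h : 'rV[R]_n -> R).

Lemma continuous_dominated f g x : (\forall y \near x, `|f y| <= `|g y|) ->
  g x = 0 -> {for x, continuous g} -> {for x, continuous f}.
Proof.
move=> fg gx0 gc.
have fx0 : f x = 0.
  by apply/eqP; rewrite -normr_le0 -(normr0 R) -gx0 (nbhs_singleton fg).
rewrite /prop_for /continuous_at fx0; apply: (@norm_cvg0 _ _ _ (nbhs x)).
have f_ge0 : \forall y \near x, cst 0 y <= `|f y| <= `|g y|.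
  by move: fg; apply: filterS => y ->; rewrite normr_ge0.
have g0 : (fun y => `|g y|) @ x --> (0 : R).
  by apply/(@norm_cvg0P _ _ _ (nbhs x)); rewrite -gx0; exact: gc.
exact: (squeeze_cvgr (a := nbhs x) f_ge0 (cvg_cst 0) g0).
Qed.

(** [g x = 0] forces [f x = 0], so the difference quotients of [f] are bounded by those of [g],
    which tend to 0. *)
Lemma is_derive_dominated f g x v : (\forall y \near x, `|f y| <= `|g y|) ->
  g x = 0 -> is_derive x v g 0 -> is_derive x v f 0.
Proof.
move=> fg gx0 [dg Dg].
have fx0 : f x = 0.
  by apply/eqP; rewrite -normr_le0 -(normr0 R) -gx0 (nbhs_singleton fg).
have xv : (fun e : R => e *: v + x) @ 0^' --> x.
  apply: cvg_within_filter.
  have : (fun e : R => e *: v + x) @ (0 : R) --> 0 *: v + x.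
    by apply: cvgD; [apply: cvgZr_tmp; exact: cvg_id|exact: cvg_cst].
  by rewrite scale0r add0r.
have f0 : e^-1 *: ((f \o shift x) (e *: v) - f x) @[e --> 0^'] --> (0 : R).
  apply/norm_cvg0P.
  have f_ge0 : \forall e \near 0^', cst 0 e <=
      `|e^-1 *: ((f \o shift x) (e *: v) - f x)| <=
      `|e^-1 *: ((g \o shift x) (e *: v) - g x)|.
    near=> e; rewrite normr_ge0 /= fx0 gx0 !subr0 !normrZ ler_wpM2l //.
    by near: e; exact: xv fg.
  apply: (squeeze_cvgr f_ge0); first exact: cvg_cst.
  apply/norm_cvg0P; have dg0 : (fun e => e^-1 *:
    ((g \o shift x) (e *: v) - g x)) @ 0^' --> 'D_v g x by exact: dg.
  by move: dg0; rewrite Dg.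
by apply: DeriveDef; [apply/cvg_ex; exists 0|apply: cvg_lim].
Unshelve. all: by end_near. Qed.

Definition piecewise p q l x : R :=
  if 0 <= l.@[x ord0] then p.@[x ord0] else q.@[x ord0].

(** Off the zero set of [l] the piece [p'] selected at [x] is selected nearby, so the error is
    locally zero; on the zero set it is at most |p - q|. *)
Lemma piecewise_near p q l x : (l.@[x ord0] = 0 -> p.@[x ord0] = q.@[x ord0]) ->
  let p' := if 0 <= l.@[x ord0] then p else q in
  \forall y \near x, `|piecewise p q l y - p'.@[y ord0]| <=
    `|(if l.@[x ord0] == 0 then p - q else 0).@[y ord0]|.
Proof.
move=> pq p'; have lc := @continuous_meval R n l x.
rewrite /p'; case: ltgtP => lx; near=> y; rewrite /piecewise.
- have -> : 0 <= l.@[y ord0] by apply: ltW; near: y; exact: cvgr_gt lc _ lx.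
  by rewrite subrr normr0.
- rewrite [0 <= _]leNgt (_ : l.@[y ord0] < 0) /= ?subrr ?normr0 //.
  by near: y; exact: cvgr_lt lc _ lx.
- case: ifP => _; first by rewrite subrr normr0.
  by rewrite mevalB distrC.
Unshelve. all: by end_near. Qed.

Lemma piecewise_continuous p q l x :
  (l.@[x ord0] = 0 -> p.@[x ord0] = q.@[x ord0]) ->
  {for x, continuous (piecewise p q l)}.
Proof.
move=> pq; have := piecewise_near pq => /=.
set p' := if 0 <= _ then p else q; set g := if _ then _ else _ => pwg.
rewrite (_ : piecewise p q l = (fun y => piecewise p q l y - p'.@[y ord0]) +
   (fun y => p'.@[y ord0])); last by apply/funext => y; rewrite /= subrK.
apply: continuousD; last exact: continuous_meval.
apply: continuous_dominated pwg _ _; last exact: continuous_meval.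
rewrite /g; case: eqP => [/pq E|_]; last by rewrite meval0.
by rewrite mevalB E subrr.
Qed.

(** Near [x] the function is the piece selected at [x] plus an error. Where [l] vanishes, the error
    is dominated by p - q, whose derivative is zero there by divisibility by [l ^+ 2]. *)
Lemma piecewise_derive p q l a x j : p - q = a * l ^+ 2 ->
  is_derive x (delta_mx ord0 j) (piecewise p q l)
    (piecewise (mderiv j p) (mderiv j q) l x).
Proof.
move=> pqE; have pq : l.@[x ord0] = 0 -> p.@[x ord0] = q.@[x ord0].
  move=> lx; apply/eqP; rewrite -subr_eq0 -mevalB pqE mevalM rmorphXn /= lx.
  by rewrite expr0n mulr0.
have := piecewise_near pq => /=.
set p' := if 0 <= _ then p else q; set g := if _ then _ else _ => pwg.
rewrite (_ : piecewise p q l = (fun y => piecewise p q l y - p'.@[y ord0]) +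
   (fun y => p'.@[y ord0])); last by apply/funext => y; rewrite /= subrK.
rewrite -[piecewise _ _ _ x]add0r; apply: is_deriveD; last first.
  have := is_derive_meval p' x j; rewrite /p' /piecewise.
  by case: ifP.
apply: is_derive_dominated pwg _ _.
  rewrite /g; case: eqP => [/pq E|_]; last by rewrite meval0.
  by rewrite mevalB E subrr.
have := is_derive_meval g x j.
rewrite (_ : (mderiv j g).@[x ord0] = 0) // /g.
case: eqP => [lx|_]; last by rewrite mderiv0 meval0.
rewrite pqE mderivM mderivXn !(mevalD, mevalM, mevalZ, rmorphXn) /= lx.
by rewrite expr0n /= !(mul0r, mulr0) addr0.
Qed.

(** Differentiating a multiple of a power of [l] lowers the power by one, so the partial derivatives
    are again piecewise, with the same [l]. *)
Lemma piecewise_Ck k p q l a : p - q = a * l ^+ k.+1 ->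
  Ck_on_open k setT (piecewise p q l).
Proof.
elim: k p q a => [|k IH] p q a pqE; split=> //.
- move=> x _; apply: piecewise_continuous => lx; apply/eqP.
  by rewrite -subr_eq0 -mevalB pqE mevalM rmorphXn /= lx expr1 mulr0.
- move=> x _; apply: piecewise_continuous => lx; apply/eqP.
  by rewrite -subr_eq0 -mevalB pqE mevalM rmorphXn /= lx exprS mul0r mulr0.
have pqE2 : p - q = (a * l ^+ k) * l ^+ 2 by rewrite pqE -mulrA -exprD addn2.
move=> j; have D x := piecewise_derive x j pqE2.
split=> [x _|]; first by have [] := D x.
rewrite (_ : (fun x => _) = piecewise (mderiv j p) (mderiv j q) l).
  apply: (IH _ _ (mderiv j a * l + k.+2%:R *: (a * mderiv j l))).
  rewrite -mderivB pqE mderivM mderivXn /= mulrDl -mulrA -exprS.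
  by rewrite -!scalerAr -!scalerAl mulrAC -mulrA.
by apply/funext => x; have [_ <-] := D x.
Qed.

Lemma closure_agree (S : set 'rV[R]_n) f g x : {for x, continuous f} ->
  {for x, continuous g} -> closure S x -> (forall y, S y -> f y = g y) ->
  f x = g x.
Proof.
move=> fc gc Sx fg; apply: contrapT => /eqP; rewrite -subr_eq0 => fgx.
have : \forall y \near x, f y - g y != 0.
  have fgc : (fun y => f y - g y) @ x --> f x - g x by exact: cvgB fc gc.
  exact: cvgr_neq0 fgc fgx.
by move=> /Sx [y [/fg ->]] /=; rewrite subrr eqxx.
Qed.

(** A partial derivative of [h] agrees with that of [p] on the interior of [A], hence by continuity
    on all of [A]; likewise for [q] on [B]. By induction on the order, both polynomial derivatives
    equal that of [h] at a common point. *)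
Lemma Ck_poly_agree k (U A B : set 'rV[R]_n) h p q : Ck_on_open k U h ->
  A `<=` U -> B `<=` U -> A `<=` closure (interior A) ->
  B `<=` closure (interior B) -> (forall x, A x -> h x = p.@[x ord0]) ->
  (forall x, B x -> h x = q.@[x ord0]) ->
  forall m, (mdeg m <= k)%N -> forall x, A x -> B x ->
  (mderivm m p).@[x ord0] = (mderivm m q).@[x ord0].
Proof.
elim: k h p q => [|k IH] h p q hC AU BU Ao Bo hp hq m mk x Ax Bx;
  case E: (mdeg m) mk => [|d] // mk;
  try by move/eqP: E; rewrite mdeg_eq0 => /eqP ->; rewrite !mderivm0m -hp ?hq.
have [j [m' [-> m'd]]] := mdeg_succ E; rewrite !mderivmDm !mderivmU1m.
have [_ /(_ j) [_ DC]] := hC.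
have DA (C : set 'rV[R]_n) u : C `<=` U -> C `<=` closure (interior C) ->
    (forall y, C y -> h y = u.@[y ord0]) ->
    forall y, C y -> 'D_(delta_mx ord0 j) h y = (mderiv j u).@[y ord0].
  move=> CU Co hu y Cy.
  have Dc : {for y, continuous ('D_(delta_mx ord0 j) h)}.
    by case: (k) DC => [|k'] [+ _]; apply; apply: CU.
  apply: (closure_agree Dc (@continuous_meval _ _ _ _) (Co _ Cy)) => z Cz.
  rewrite -derive_meval; apply: near_eq_derive.
  by move: Cz; apply: filterS => t /hu.
apply: (IH _ _ _ DC) => //; first exact: DA.
- exact: DA.
- by rewrite m'd.
Qed.

End PiecewiseSmoothness.

(** * Simplicial complexes *)

Section FaceIdeals.
Variables (R : realType) (n : nat).
Implicit Types (s t : {fset 'rV[R]_n}) (p l : {mpoly R[n]}).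

(** By the Leibniz rule every term of the derivative keeps at least [k] of the [k.+1] factors in
    [I]. *)
Lemma mderiv_ideal_pow (I : set {mpoly R[n]}) k p j :
  ideal_pow I k.+1 p -> ideal_pow I k (mderiv j p).
Proof.
move: p; apply: (@ideal_gen_ind _ _ (fun p => ideal_pow I k (mderiv j p))).
- by rewrite mderiv0; apply: ideal_gen0.
- by move=> p q ? ?; rewrite mderivD; apply: ideal_genD.
move=> a _ [g Ig ->]; rewrite mderivM; apply: ideal_genD.
  rewrite big_ord_recl mulrA; apply: ideal_pow_prod => i; exact: Ig.
apply: ideal_genM; elim: k g Ig => [|k IH] g Ig.
  (* For a single factor the target is the power 0, the unit ideal; [q] is written as a multiple of
     the empty product. *)
  set q := mderiv _ _; have -> : q = q * \prod_(i < 0) 0.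
    by rewrite big_ord0 mulr1.
  by apply: ideal_pow_prod; case.
rewrite big_ord_recl mderivM; apply: ideal_genD.
  by apply: ideal_pow_prod => i; apply: Ig.
by apply: ideal_powS; [exact: Ig|apply: IH => i; apply: Ig].
Qed.

Lemma vanishing_ideal_pow X k p m : ideal_pow (vanishing_ideal X) k p ->
  (mdeg m < k)%N -> vanishing_ideal X (mderivm m p).
Proof.
elim: k m p => // k IH m p Ip; case E: (mdeg m) => [|d] mk.
  have -> : m = mnm0 by apply/eqP; rewrite -mdeg_eq0 E.
  move=> x Xx; rewrite mderivm0m; move: p Ip; apply: ideal_gen_ind.
  - exact: meval0.
  - by move=> p q p0 q0; rewrite mevalD p0 q0 addr0.
  move=> a _ [g Ig ->].
  by rewrite big_ord_recl !mevalM (Ig ord0 _ Xx) mul0r mulr0.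
have [j [m' [-> m'd]]] := mdeg_succ E; rewrite mderivmDm mderivmU1m.
by apply: IH; [exact: mderiv_ideal_pow|rewrite m'd].
Qed.

Lemma homogenize_affine_form_mem s (v : 'rV[R]_n) N j : v \in s ->
  (forall w, hull s w -> (w - v) *m N = 0) ->
  homogenized_ideal (vanishing_ideal (hull s)) (linear_form v N j).
Proof.
move=> vs sN; have a0 : vanishing_ideal (hull s) (affine_form v N j).
  by move=> x /sN; rewrite meval_affine_form => ->; rewrite mxE.
apply: sub_ideal_gen; exists (affine_form v N j) => //.
rewrite -homogenize_affine_form; have := msize_affine_form v N j.
(* [homogenized_ideal] homogenizes to the exact degree, which is one only for size two. Size zero
   means the zero form; size one would be a nonzero constant, excluded by the vertex [v]. *)
case E : (mmeasure _ _) => [|[|[|?]]] // _.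
  by move/eqP: E; rewrite msize_poly_eq0 => /eqP ->; rewrite !linear0.
have /msize_poly1P[c c0 aE] : msize (affine_form v N j) == 1%N by rewrite E.
by have := a0 _ (hull_vertex vs); rewrite aE mevalC => /eqP; rewrite (negbTE c0).
Qed.

Lemma homogenize_face_ideal s k d p : s != fset0 -> (msize p <= d.+1)%N ->
  (forall m, (mdeg m <= k)%N -> vanishing_ideal (hull s) (mderivm m p)) ->
  ideal_pow (homogenized_ideal (vanishing_ideal (hull s))) k.+1 (homogenize d p).
Proof.
move=> /affine_projection[v [N [vs NN sN sp]]] pd p0.
have := homogenize_ideal_pow NN sp pd p0.
apply: (@ideal_pow_morph _ _ idfun) => _ [j _ <-].
exact: homogenize_affine_form_mem.
Qed.

(** * An affine form vanishing on a facet of an [n]-simplex *)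

Section Facet.
Variables (sg tau : {fset 'rV[R]_n}) (l : {mpoly R[n]}).
Hypotheses (sg_indep : affinely_independent sg) (sg_card : #|` sg|%fset = n.+1)
  (tau_card : #|` tau|%fset = n) (tau_sg : (tau `<=` sg)%fset)
  (l_size : msize l = 2%N) (l_tau : vanishing_ideal (hull tau) l).

Lemma facet_vertex : exists2 v, v \notin tau & sg = (v |` tau)%fset.
Proof.
have /cardfs1P[v vE] : #|` sg `\` tau|%fset == 1%N.
  by rewrite cardfsDS // sg_card tau_card subSnn.
exists v; first by have := fset11 v; rewrite -vE inE => /andP[].
by apply/fsetP => w; rewrite !inE -in_fset1 -vE !inE;
  case: (boolP (w \in tau)) => [/(fsubsetP tau_sg)|] //= _; rewrite ?orbF ?andbT.
Qed.

Lemma facet_form_neq0 v : v \notin tau -> v \in sg -> l.@[v ord0] != 0.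
Proof.
move=> vtau vsg; apply: contra_eqN l_size => /eqP lv.
suff -> : l = 0 by rewrite msize0.
apply: (affine_vanish sg_indep sg_card); rewrite ?l_size // => w wsg.
have [u utau sgE] := facet_vertex.
have uv : u = v by move: vsg; rewrite sgE !inE (negbTE vtau) orbF => /eqP.
by move: wsg; rewrite sgE !inE uv => /predU1P[->//|wt]; apply/l_tau/hull_vertex.
Qed.

(** An affine polynomial is determined by its values at the vertices of [sg], and [a] and [l] both
    vanish at all but [v]; so [c] is the ratio of their values at [v]. *)
Lemma affine_multiple a : (msize a <= 2)%N -> vanishing_ideal (hull tau) a ->
  exists c, a = c *: l.
Proof.
move=> a2 a_tau; have [v vtau sgE] := facet_vertex.
have vsg : v \in sg by rewrite sgE fset1U1.
have lv := facet_form_neq0 vtau vsg; exists (a.@[v ord0] / l.@[v ord0]).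
apply/eqP; rewrite -subr_eq0; apply/eqP; apply: (@affine_vanish _ _ sg) => //.
  apply: leq_trans (msizeD_le _ _) _; rewrite msizeN geq_max a2.
  by apply: leq_trans (msizeZ_le _ _) _; rewrite l_size.
move=> w; rewrite mevalB mevalZ sgE !inE => /predU1P[->|wt].
  by rewrite divfK ?subrr.
by have hw := hull_vertex wt; rewrite (l_tau hw) (a_tau _ hw) mulr0 subrr.
Qed.

Lemma homogenize_facet_ideal k d p : tau != fset0 -> (msize p <= d.+1)%N ->
  (forall m, (mdeg m <= k)%N -> vanishing_ideal (hull tau) (mderivm m p)) ->
  ideal_gen [set homogenize 1 l ^+ k.+1] (homogenize d p).
Proof.
move=> /affine_projection[v [N [vs NN sN sp]]] pd p0.
apply: ideal_pow_principal (homogenize_ideal_pow NN sp pd p0) => _ [j _ <-].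
have [|c cE] := @affine_multiple (affine_form v N j) (msize_affine_form _ _ _).
  by move=> x /sN; rewrite meval_affine_form => ->; rewrite mxE.
by exists (mpolyC _ c); rewrite -homogenize_affine_form cE linearZ mul_mpolyC.
Qed.

(** [c] is the coefficient of [x] at [v], the only vertex outside the facet. Hence the simplex lies
    on one side of it. *)
Lemma facet_form_hull v x : v \notin tau -> v \in sg -> hull sg x ->
  exists2 c, 0 <= c & l.@[x ord0] = c * l.@[v ord0].
Proof.
move=> vtau vsg [c [c0 c1 ->]]; exists (c v); first exact: c0.
rewrite meval_affine ?l_size // (big_fsetD1 v) //= big_seq big1 ?addr0 // => w.
rewrite !inE => /andP[wv wsg]; have [u utau sgE] := facet_vertex.
have uv : u = v by move: vsg; rewrite sgE !inE (negbTE vtau) orbF => /eqP.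
move: wsg; rewrite sgE !inE uv (negbTE wv) /= => wt.
by rewrite l_tau ?mulr0 //; apply: hull_vertex.
Qed.

End Facet.

Section FullDimensional.
Variable s : {fset 'rV[R]_n}.
Hypotheses (s_indep : affinely_independent s) (s_card : #|` s|%fset = n.+1).

Lemma closed_hull : closed (hull s).
Proof.
have [lam [lam2 lam1 lamK]] := barycentric_coordinates s_indep s_card.
move=> x sx; apply/(hull_barycentric s_indep lam1 lamK) => w ws.
rewrite leNgt; apply/negP => lx.
have /sx[y [/(hull_barycentric s_indep lam1 lamK) sy]] :
    \forall y \near x, (lam w).@[(y : 'rV[R]_n) ord0] < 0.
  exact: cvgr_lt (@continuous_meval _ _ (lam w) x) _ lx.
by move=> /= ly; have := lt_le_trans ly (sy _ ws); rewrite ltxx.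
Qed.

(** All coordinates of the barycentre [b] are positive, so each point x + e(b - x) with 0 < e <= 1
    is interior; a small [e] brings it close to [x]. *)
Lemma closure_interior_hull : hull s `<=` closure (interior (hull s)).
Proof.
have [lam [lam2 lam1 lamK]] := barycentric_coordinates s_indep s_card.
pose a : R := n.+1%:R^-1; have a0 : 0 < a by rewrite invr_gt0 ltr0n.
pose b := \sum_(w <- s) a *: w.
have lamb w : w \in s -> (lam w).@[b ord0] = a.
  move=> ws; rewrite (barycentric_unique s_indep lam1 lamK (c := fun=> _)) //.
  rewrite (sum_fset_nth (fun=> a) s_card) sumr_const card_ord -mulr_natr mulVf //.
  by rewrite pnatr_eq0.
move=> x sx B Bx.
have cv : (fun e : R => x + e *: (b - x)) @ (0 : R) --> x + 0 *: (b - x).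
  by apply: cvgD; [exact: cvg_cst|apply: cvgZr_tmp; exact: cvg_id].
rewrite scale0r addr0 in cv.
have /nbhs_ballP[d /= d0 dB] := cv _ Bx.
pose e := Num.min (d / 2) 1.
have e0 : 0 < e by rewrite lt_min ltr01 andbT divr_gt0.
have e1 : e <= 1 by rewrite ge_min lexx orbT.
exists (x + e *: (b - x)); split; last first.
  apply: dB; rewrite /ball /= sub0r normrN gtr0_norm // gt_min; apply/orP; left.
  by rewrite ltr_pdivrMr // ltr_pMr // ltr1n.
suff : \forall y \near x + e *: (b - x),
    forall w, w \in s -> 0 < (lam w).@[(y : 'rV[R]_n) ord0].
  apply: filterS => y sy; apply/(hull_barycentric s_indep lam1 lamK) => w /sy.
  exact: ltW.
apply: near_all_in => w ws.
apply: cvgr_gt (@continuous_meval _ _ (lam w) _) _ _.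
rewrite meval_line // mulrBr addrCA -{1}[(lam w).@[x ord0]]mul1r -mulrBl lamb //.
have /(hull_barycentric s_indep lam1 lamK) /(_ _ ws) lx := sx.
by rewrite ltr_pwDl ?mulr_gt0 // mulr_ge0 // subr_ge0.
Qed.

End FullDimensional.

End FaceIdeals.

(** * Adjacent simplices and gluing along chains *)

Section Gluing.
Variables (R : realType) (n : nat) (D : {fset {fset 'rV[R]_n}}).
Hypothesis D_complex : simplicial_complex D.
Implicit Types (sg tau : {fset 'rV[R]_n}) (l : {mpoly R[n]}).

Lemma facesP j sg : sg \in faces D j -> sg \in D /\ #|` sg|%fset = j.+1.
Proof. by rewrite !inE /= => /andP[sgD /eqP sgj]. Qed.

Lemma faces_independent j sg : sg \in faces D j -> affinely_independent sg.
Proof. by move=> /facesP[sgD _]; apply: face_independent D_complex _ sgD. Qed.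

(* Two simplices on the same side of a common facet overlap beyond that facet. *)
Lemma same_side_eq sg sg' tau l : (0 < n)%N ->
  sg \in faces D n -> sg' \in faces D n ->
  (tau `<=` sg)%fset -> (tau `<=` sg')%fset -> #|` tau|%fset = n ->
  msize l = 2%N -> vanishing_ideal (hull tau) l ->
  (forall v v', v \in sg -> v \notin tau -> v' \in sg' -> v' \notin tau ->
     0 < l.@[v ord0] * l.@[v' ord0]) -> sg = sg'.
Proof.
move=> n0 sgn sgn' tsg tsg' tn l2 lt side.
have [sgD sgc] := facesP sgn; have [sgD' sgc'] := facesP sgn'.
have ind := faces_independent sgn; have ind' := faces_independent sgn'.
have [v vt sgE] := facet_vertex sgc tn tsg.
have [v' vt' sgE'] := facet_vertex sgc' tn tsg'.
have vsg : v \in sg by rewrite sgE fset1U1.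
have vsg' : v' \in sg' by rewrite sgE' fset1U1.
have {}side := side v v' vsg vt vsg' vt'.
apply: contrapT => /eqP neq.
have vv' : v != v' by apply: contraNneq neq => vv'; rewrite sgE sgE' vv'.
have meet : (sg `&` sg')%fset = tau.
  apply/fsetP => w; rewrite sgE sgE' !inE; case: (boolP (w \in tau)) => wt.
    by rewrite !orbT.
  by rewrite !orbF; case: eqVneq => // ->; rewrite (negbTE vv').
have [lam [lam2 lam1 lamK]] := barycentric_coordinates ind' sgc'.
(* The barycentre [b] of [tau] has, in [sg'], positive coordinates at the vertices of [tau] and
   coordinate zero at [v']. *)
pose a : R := n%:R^-1; have a0 : 0 < a by rewrite invr_gt0 ltr0n.
pose b := \sum_(w <- tau) a *: w.
have suma : \sum_(w <- tau) a = 1.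
  rewrite (sum_fset_nth (fun=> a) tn) sumr_const card_ord -mulr_natr mulVf //.
  by rewrite pnatr_eq0 -lt0n.
have tb : hull tau b by exists (fun=> a); split=> // w _; apply: ltW.
have lamb w : w \in sg' -> (lam w).@[b ord0] = if w \in tau then a else 0.
  move=> ws; rewrite -(barycentric_unique ind' lam1 lamK (w := w)
    (c := fun w => if w \in tau then a else 0)) //.
    congr (_.@[(_ : 'rV_n) ord0]).
    rewrite /b -(sum_fset_extend (fun w => a *: w) tsg'); apply: eq_bigr => u _.
    by case: ifP => // _; rewrite scale0r.
  by rewrite -suma sum_fset_extend.
have lamv' : 0 < (lam v').@[v ord0].
  have lv : l.@[v ord0] = (lam v').@[v ord0] * l.@[v' ord0].
    rewrite -{1}(lamK v) meval_affine ?l2 // (big_fsetD1 v') //= big_seq.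
    rewrite big1 ?addr0 // => w; rewrite sgE' !inE => /andP[/negbTE ->] /= wt.
    by rewrite lt ?mulr0 //; apply: hull_vertex.
  have lv'0 : l.@[v' ord0] != 0 by apply: contraTneq side => ->; rewrite mulr0 ltxx.
  by move: side; rewrite lv -mulrA pmulr_lgt0 // -expr2 exprn_even_gt0.
(* Towards [v] the zero coordinate at [v'] increases, [l] having the same sign at [v] and [v'];
   hence a short step from [b] stays in [sg']. *)
have [|e /andP[e0 e1] He] := @small_step_ge0 R _ sg'
  (fun w => (lam w).@[b ord0]) (fun w => (lam w).@[v ord0] - (lam w).@[b ord0]).
  move=> w ws; rewrite lamb //; case: ifP => wt; first by left.
  right; rewrite lexx subr0; move: ws; rewrite sgE' !inE wt orbF => /eqP ->.
  by rewrite ltW.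
pose x := b + e *: (v - b).
have sgx : hull sg x.
  apply: hull_convex; [exact: hull_mono tb|exact: hull_vertex|].
  by rewrite ltW.
have sgx' : hull sg' x.
  apply/(hull_barycentric ind' lam1 lamK) => w ws; rewrite meval_line //.
  by apply: He => //; rewrite lexx ltW.
(* The hulls meet only in that of [tau], where [l] vanishes; but at [x] it is [e] times its nonzero
   value at [v]. *)
have : hull tau x.
  by rewrite -meet -(face_meet D_complex sgD sgD').
move=> /lt /eqP; rewrite meval_line ?l2 // lt // add0r subr0 mulf_eq0.
by rewrite gt_eqF //= => /eqP lv0; move: side; rewrite lv0 mul0r ltxx.
Qed.

Hypotheses (D_dim : has_dimension D n) (D_pure : pure D).

Lemma pure_face sg : sg \in D -> exists2 t, t \in faces D n & (sg `<=` t)%fset.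
Proof.
elim: {sg}(n.+1 - _)%N {-2}sg (leqnn (n.+1 - #|` sg|%fset)) => [|k IH] sg.
  rewrite leqn0 subn_eq0 => nsg sgD; exists sg => //; rewrite !inE sgD /=.
  by rewrite eqn_leq nsg (D_dim.2 _ sgD).
move=> sgk sgD; have [|] := pselect (exists t,
    [/\ t \in D, (sg `<=` t)%fset & t <> sg]).
  move=> [t [tD st tn]]; have : (#|` sg| < #|` t|)%fset%N.
    by apply: fproper_ltn_card; rewrite fproperEneq st eq_sym andbT; apply/eqP.
  have := D_dim.2 _ tD => tc sc; have [|t' t'n tt'] := IH t _ tD; first by lia.
  by exists t' => //; apply: fsubset_trans st tt'.
move=> nt; exists sg => //; apply: D_pure => // t tD st.
by apply: contrapT => tsg; apply: nt; exists t.
Qed.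

(** The pasting lemma for finitely many closed sets; closedness of the union is carried along since
    each step pastes two closed sets. *)
Lemma within_simplices_continuous (r : seq {fset 'rV[R]_n}) (F : 'rV[R]_n -> R)
    (f : {fset 'rV[R]_n} -> {mpoly R[n]}) :
  (forall sg, sg \in r -> sg \in faces D n) ->
  (forall sg, sg \in r -> forall x, hull sg x -> F x = (f sg).@[x ord0]) ->
  closed [set x | exists2 sg, sg \in r & hull sg x] /\
  {within [set x | exists2 sg, sg \in r & hull sg x], continuous F}.
Proof.
elim: r => [|sg r IH] rD rF.
  rewrite (_ : [set x | _] = set0); last by apply/seteqP; split=> x // [].
  by split; [exact: closed0|exact: continuous_subspace0].
rewrite (_ : [set x | _] = hull sg `|` [set x | exists2 sg, sg \in r & hull sg x]).
  have [|| rc rFc] := IH.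
  - by move=> t tr; apply: rD; rewrite inE tr orbT.
  - by move=> t tr; apply: rF; rewrite inE tr orbT.
  have sgn := rD _ (mem_head _ _); have [_ sgc] := facesP sgn.
  have sg_closed := closed_hull (faces_independent sgn) sgc.
  split; first exact: closedU.
  apply: withinU_continuous => //.
  apply: (@subspace_eq_continuous _ (hull sg) R
    (fun x : 'rV_n => (f sg).@[x ord0]) F).
    by move=> x /set_mem xsg; rewrite (rF sg) ?mem_head.
  by apply: continuous_subspaceT; exact: continuous_meval.
apply/seteqP; split=> [x [t]|x [xsg|[t tr tx]]].
- by rewrite inE => /predU1P[->|tr] tx; [left|right; exists t].
- by exists sg; rewrite ?mem_head.
- by exists t; rewrite // inE tr orbT.
Qed.

(** Heredity in the form used for gluing: a property spreads along a chain of [n]-faces that all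
    contain the meet of [sg] and [sg']. *)
Lemma hereditary_ind (P : {fset 'rV[R]_n} -> Prop) sg sg' : hereditary D ->
  sg \in faces D n -> sg' \in faces D n -> (sg `&` sg')%fset \in D ->
  (forall a b, a \in faces D n -> b \in faces D n ->
     (sg `&` sg' `<=` a)%fset -> (sg `&` sg' `<=` b)%fset ->
     interior_faces D n.-1 (a `&` b)%fset -> P a -> P b) ->
  P sg -> P sg'.
Proof.
move=> her sgn sgn' meetD step Psg.
have [m [c [c0 cm cn cs]]] := her _ _ sgn sgn' meetD; rewrite -cm.
elim: {-2}m (leqnn m) => [|k IH] km; first by rewrite c0.
have [an ak] := cn _ (ltnW km); have [bn bk] := cn _ km.
exact: step _ _ an bn ak bk (cs _ km) (IH (ltnW km)).
Qed.

Lemma polyhedron_pure :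
  polyhedron D = [set x | exists2 sg, sg \in enum_fset (faces D n) & hull sg x].
Proof.
apply/seteqP; split=> x [sg sgD xsg].
  by have [t tn st] := pure_face sgD; exists t => //; apply: hull_mono xsg.
by exists sg => //; have [] := facesP sgD.
Qed.

End Gluing.

(** * The three implications *)

Section MainTheorem.
Variables (R : realType) (n i : nat) (D : {fset {fset 'rV[R]_n}})
  (r s : {fset 'rV[R]_n} -> nat) (ell f : {fset 'rV[R]_n} -> {mpoly R[n]}).
Hypotheses (D_complex : simplicial_complex D) (le_i_n : (i + 2 <= n)%N)
  (ell_linear : forall tau, interior_faces D n.-1 tau ->
    msize (ell tau) = 2%N /\ vanishing_ideal (hull tau) (ell tau)).

Let n_gt0 : (0 < n)%N. Proof. by apply: leq_trans le_i_n; rewrite addn2. Qed.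

(** A facet has dimension [n.-1], hence [n.-1.+1] vertices, which is [n] because [n] is positive. *)
Let interior_card tau : interior_faces D n.-1 tau -> #|` tau|%fset = n.
Proof. by move=> [/facesP[_ ->] _]; rewrite prednK. Qed.

(** On each of the two simplices the smooth extension [h] has the derivatives of the polynomial
    there, so those of the difference vanish on [tau] up to order r_tau. On each beta they vanish up
    to order s_beta by the definition of splines. *)
Lemma spline_Jhom d tau sg sg' :
  (forall sg, sg \in faces D n -> (msize (f sg) <= d.+1)%N) ->
  spline_space D i r s f -> interior_faces D n.-1 tau ->
  sg \in faces D n -> sg' \in faces D n -> (sg `&` sg')%fset = tau ->
  Jhom D i r s ell tau (homogenize d (f sg) - homogenize d (f sg')).
Proof.
move=> fd [F [FE _ FC Fs]] tauI sgn sgn' meet.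
have [_ sgc] := facesP sgn; have [_ sgc'] := facesP sgn'.
have ind := faces_independent D_complex sgn.
have ind' := faces_independent D_complex sgn'.
have tsg : (tau `<=` sg)%fset by rewrite -meet fsubsetIl.
have tsg' : (tau `<=` sg')%fset by rewrite -meet fsubsetIr.
have [l2 lt] := ell_linear tauI; have tn := interior_card tauI.
rewrite -linearB /=; set p := f sg - f sg'.
have pd : (msize p <= d.+1)%N.
  by apply: leq_trans (msizeD_le _ _) _; rewrite msizeN geq_max !fd.
split.
  apply: (homogenize_facet_ideal ind sgc tn tsg l2 lt) => //.
    by rewrite -cardfs_gt0 tn.
  move=> m mr x tx; have [U [_ starU [h hC hF]]] := FC _ tauI.
  rewrite /p mderivmB mevalB.
  rewrite (@Ck_poly_agree _ _ (r tau) U (hull sg) (hull sg')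
    h (f sg) (f sg')) ?subrr //.
  - by move=> y ysg; apply: starU; exists sg.
  - by move=> y ysg; apply: starU; exists sg'.
  - exact: closure_interior_hull.
  - exact: closure_interior_hull.
  - by move=> y ysg; rewrite hF ?(FE sg) //; exists sg.
  - by move=> y ysg; rewrite hF ?(FE sg') //; exists sg'.
  - exact: hull_mono tx.
  - exact: hull_mono tx.
move=> b [bi btau]; have [bD _] := facesP bi.
apply: homogenize_face_ideal => //; first exact: face_nonempty D_complex _ bD.
move=> m ms x bx; rewrite /p mderivmB mevalB (Fs b sg sg') ?subrr //.
- exact: fsubset_trans tsg.
- exact: fsubset_trans tsg'.
Qed.

Lemma Jhom_Jcheck d tau p q :
  Jhom D i r s ell tau (homogenize d p - homogenize d q) ->
  Jcheck D i r s ell tau (p - q).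
Proof.
move=> [Jl Js]; rewrite -(homogenizeK d p) -(homogenizeK d q) -rmorphB.
split.
  apply: ideal_gen_morph Jl => _ ->; rewrite rmorphXn /= homogenizeK.
  exact: sub_ideal_gen.
move=> b bi; apply: ideal_pow_morph (Js b bi) => g.
move: g; apply: ideal_gen_ind.
- by move=> x _; rewrite rmorph0 meval0.
- by move=> g h Ig Ih x bx; rewrite rmorphD mevalD Ig ?Ih ?addr0.
- by move=> a _ [g Ig <-] x bx; rewrite rmorphM /= homogenizeK mevalM Ig ?mulr0.
Qed.

Hypotheses (D_dim : has_dimension D n) (D_pure : pure D)
  (D_hereditary : hereditary D)
  (f_Jcheck : forall tau sg sg', interior_faces D n.-1 tau ->
     sg \in faces D n -> sg' \in faces D n -> (sg `&` sg')%fset = tau ->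
     Jcheck D i r s ell tau (f sg - f sg')).

(** A common point [x] lies in the meet of [sg] and [sg'], hence in every facet crossed by the chain
    that joins them; there [ell] vanishes, so the value at [x] does not change. *)
Lemma Jcheck_agree sg sg' x : sg \in faces D n -> sg' \in faces D n ->
  hull sg x -> hull sg' x -> (f sg).@[x ord0] = (f sg').@[x ord0].
Proof.
move=> sgn sgn' sgx sgx'; have [sgD _] := facesP sgn; have [sgD' _] := facesP sgn'.
have meetx : hull (sg `&` sg')%fset x by rewrite -(face_meet D_complex).
have meet0 : (sg `&` sg')%fset != fset0.
  apply: contraPneq meetx => ->; case=> c [_ + _].
  by rewrite big_seq_fset0 => /esym/eqP; rewrite oner_eq0.
pose P a := (f a).@[x ord0] = (f sg).@[x ord0]; suff : P sg' by [].
apply: (hereditary_ind D_hereditary sgn sgn') => //.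
  by apply: face_subset D_complex _ _ sgD (fsubsetIl _ _) meet0.
rewrite /P => a b an bn sa sb abI <-.
have [/ideal_gen1P[c abE] _] := f_Jcheck abI an bn erefl.
have [_ l0] := ell_linear abI.
apply/esym/eqP; rewrite -subr_eq0 -mevalB abE mevalM rmorphXn /=.
rewrite l0 ?exprS ?mul0r ?mulr0 //.
by apply: hull_mono meetx; rewrite fsubsetI sa.
Qed.

(** Each [n]-simplex containing [tau] lies on one side of the hyperplane [l = 0], and at most one
    lies on each side. So on the star [F] is the piecewise function of two polynomials that differ
    by a multiple of [l ^+ (r tau).+1]. *)
Lemma star_Ck F tau : interior_faces D n.-1 tau ->
  (forall sg, sg \in faces D n -> forall x, hull sg x -> F x = (f sg).@[x ord0]) ->
  Ck_on (r tau) (star D tau) F.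
Proof.
move=> tauI FE; have [l2 lt] := ell_linear tauI; have tn := interior_card tauI.
set l := ell tau in l2 lt.
pose side (e : R) sg := [/\ sg \in faces D n, (tau `<=` sg)%fset &
  forall v, v \in sg -> v \notin tau -> 0 < e * l.@[v ord0]].
have sideP sg : sg \in faces D n -> (tau `<=` sg)%fset -> side 1 sg \/ side (-1) sg.
  move=> sgn tsg; have [_ sgc] := facesP sgn.
  have ind := faces_independent D_complex sgn.
  have [v vt sgE] := facet_vertex sgc tn tsg.
  have lv := facet_form_neq0 ind sgc tn tsg l2 lt vt _.
  have vE w : w \in sg -> w \notin tau -> w = v.
    by rewrite sgE !inE => /predU1P[//|->].
  have {}lv : l.@[v ord0] != 0 by apply: lv; rewrite sgE fset1U1.
  case: (ltgtP l.@[v ord0] 0) lv => // lv _; [right|left]; split=> // w ws wt.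
    by rewrite (vE w) // mulN1r oppr_gt0.
  by rewrite (vE w) // mul1r.
have side_uniq e sg sg' : side e sg -> side e sg' -> sg = sg'.
  move=> [sgn tsg le] [sgn' tsg' le'].
  apply: (same_side_eq D_complex n_gt0 sgn sgn' tsg tsg' tn l2 lt).
  move=> v v' vs vt vs' vt'; have := mulr_gt0 (le _ vs vt) (le' _ vs' vt').
  rewrite mulrACA pmulr_rgt0 // -expr2 exprn_even_gt0 //=.
  by apply: contraTneq (le _ vs vt) => ->; rewrite mul0r ltxx.
have side_ge0 e sg x : side e sg -> hull sg x -> 0 <= e * l.@[x ord0].
  move=> [sgn tsg le] sgx; have [_ sgc] := facesP sgn.
  have [v vt sgE] := facet_vertex sgc tn tsg.
  have vs : v \in sg by rewrite sgE fset1U1.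
  have [c c0 ->] := facet_form_hull sgc tn tsg l2 lt vt vs sgx.
  by rewrite mulrCA mulr_ge0 // ltW // le.
have glue p q a : p - q = a * l ^+ (r tau).+1 ->
    (forall sg, side 1 sg -> f sg = p) -> (forall sg, side (-1) sg -> f sg = q) ->
    Ck_on (r tau) (star D tau) F.
  move=> pqE fp fq; exists setT; split=> //; first exact: openT.
  exists (piecewise p q l); first exact: piecewise_Ck pqE.
  move=> x [sg [sgn tsg sgx]]; rewrite (FE sg) // /piecewise.
  have [sgs|sgs] := sideP _ sgn tsg.
    by have := side_ge0 _ _ _ sgs sgx; rewrite mul1r => ->; rewrite fp.
  have := side_ge0 _ _ _ sgs sgx; rewrite mulN1r oppr_ge0 => lx.
  (* On the negative side [piecewise] selects [p] only where [l = 0], and there [p] and [q]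
     agree. *)
  rewrite (fq sg) //; case: ifP => // lx'.
  apply/eqP; rewrite -subr_eq0 -mevalB pqE mevalM rmorphXn /=.
  have /le_anti -> : l.@[x ord0] <= 0 <= l.@[x ord0] by rewrite lx lx'.
  by rewrite exprS mul0r mulr0.
(* If one side is empty, the polynomial of the other is taken for both, with [a = 0]; if both are
   empty, zero is taken. *)
have [[s1 s1P]|n1] := pselect (exists sg, side 1 sg); last first.
  have [[s2 s2P]|n2] := pselect (exists sg, side (-1) sg); last first.
    apply: (glue 0 0 0); rewrite ?subrr ?mul0r // => sg sgP.
    - by case: n1; exists sg.
    - by case: n2; exists sg.
  apply: (glue (f s2) (f s2) 0); rewrite ?subrr ?mul0r // => sg sgP.
    by case: n1; exists sg.
  by rewrite (side_uniq _ _ _ sgP s2P).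
have [[s2 s2P]|n2] := pselect (exists sg, side (-1) sg); last first.
  apply: (glue (f s1) (f s1) 0); rewrite ?subrr ?mul0r // => sg sgP.
    by rewrite (side_uniq _ _ _ sgP s1P).
  by case: n2; exists sg.
(* At a common vertex outside [tau] the form [l] would be both positive and negative. *)
have meet : (s1 `&` s2)%fset = tau.
  case: s1P s2P => [n1 t1 l1] [n2 t2 l2'].
  apply/eqP; rewrite eqEfsubset; apply/andP; split; last by rewrite fsubsetI t1.
  apply/fsubsetP => v.
  rewrite inE => /andP[v1 v2]; apply: contraT => vt.
  have := addr_gt0 (l1 _ v1 vt) (l2' _ v2 vt).
  by rewrite mul1r mulN1r subrr ltxx.
have [[s1n _ _] [s2n _ _]] := (s1P, s2P).
have [/ideal_gen1P[a aE] _] := f_Jcheck tauI s1n s2n meet.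
by apply: (glue _ _ a aE) => sg sgP; [rewrite (side_uniq _ _ _ sgP s1P)|
  rewrite (side_uniq _ _ _ sgP s2P)].
Qed.

Lemma Jcheck_spline : spline_space D i r s f.
Proof.
(* A polynomial of some [n]-face containing [x] is chosen; by [Jcheck_agree] the value is
   independent of the choice. The default [fset0] occurs only off the polyhedron. *)
pose F (x : 'rV[R]_n) :=
  (f (xget fset0 [set sg | sg \in faces D n /\ hull sg x])).@[x ord0].
have FE sg : sg \in faces D n -> forall x, hull sg x -> F x = (f sg).@[x ord0].
  move=> sgn x sgx; rewrite /F.
  have [|tn tx] := @xgetPex _ fset0 [set sg | sg \in faces D n /\ hull sg x].
    by exists sg.
  exact: Jcheck_agree.
exists F; split=> //.
- rewrite polyhedron_pure //.
  by have [] := @within_simplices_continuous _ _ _ D_complex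
    (enum_fset (faces D n)) F f (fun _ h => h) FE.
- by move=> tau tauI; apply: star_Ck.
move=> b sg sg' bi sgn sgn' bsg bsg' m ms x bx.
have [bD _] := facesP bi; have [sgD _] := facesP sgn.
have b_meet : (b `<=` sg `&` sg')%fset by rewrite fsubsetI bsg.
have meet0 : (sg `&` sg')%fset != fset0.
  apply: contraNneq (face_nonempty D_complex bD) => E.
  by move: b_meet; rewrite E fsubset0.
(* Every simplex of the chain contains [b], so each step crosses a facet containing [b] and
   preserves the derivatives there up to order [s b]. *)
pose P a := (mderivm m (f a)).@[x ord0] = (mderivm m (f sg)).@[x ord0].
suff : P sg' by [].
apply: (hereditary_ind D_hereditary sgn sgn') => //.
  by apply: face_subset D_complex _ _ sgD (fsubsetIl _ _) meet0.
rewrite /P => a c an cn sa sc acI <-.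
have [_ /(_ b)] := f_Jcheck acI an cn erefl.
have b_ac : (b `<=` a `&` c)%fset.
  by rewrite fsubsetI (fsubset_trans b_meet sa) (fsubset_trans b_meet sc).
move=> /(_ (conj bi b_ac)) /vanishing_ideal_pow /(_ ms x bx).
by rewrite mderivmB mevalB => /eqP; rewrite subr_eq0 => /eqP.
Qed.

End MainTheorem.

Theorem theorem3p5 (R : realType) (n i : nat) (Delta : {fset {fset 'rV[R]_n}})
    (r s : {fset 'rV[R]_n} -> nat) (ell f : {fset 'rV[R]_n} -> {mpoly R[n]})
    (d : nat)
    (Delta_complex : simplicial_complex Delta)
    (Delta_dim : has_dimension Delta n)
    (Delta_pure : pure Delta)
    (Delta_hereditary : hereditary Delta)
    (le_i_n : (i + 2 <= n)%N)
    (ell_linear : forall tau, interior_faces Delta n.-1 tau ->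
       msize (ell tau) = 2%N /\ vanishing_ideal (hull tau) (ell tau))
    (le_deg_d : forall sg, sg \in faces Delta n -> (msize (f sg) <= d.+1)%N) :
  [<-> spline_space Delta i r s f;
       forall tau sg sg', interior_faces Delta n.-1 tau ->
         sg \in faces Delta n -> sg' \in faces Delta n ->
         (sg `&` sg')%fset = tau ->
         Jhom Delta i r s ell tau
           (homogenize d (f sg) - homogenize d (f sg'));
       forall tau sg sg', interior_faces Delta n.-1 tau ->
         sg \in faces Delta n -> sg' \in faces Delta n ->
         (sg `&` sg')%fset = tau ->
         Jcheck Delta i r s ell tau (f sg - f sg')].
Proof.
tfae.
- move=> f_spline tau sg sg' tauI sgn sgn' meet.
  exact: spline_Jhom le_deg_d f_spline tauI sgn sgn' meet.
- by move=> f_Jhom tau sg sg' tauI sgn sgn' meet; apply/Jhom_Jcheck/f_Jhom.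
- move=> f_Jcheck; exact: (Jcheck_spline Delta_complex le_i_n ell_linear
    Delta_dim Delta_pure Delta_hereditary f_Jcheck).
Qed.
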